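(* The category $\mathsf{QCB_0}(\mathbf{HP})$ of hyperprojective qcb$_0$-spaces is cartesian closed, countably complete and countably co-complete. It inherits its exponentials, countable products, countable co-products, equalizers and co-equalizers from $\mathsf{QCB_0}$ (i.e., the corresponding $\mathsf{QCB_0}$-constructions applied to objects of $\mathsf{QCB_0}(\mathbf{HP})$ yield objects of $\mathsf{QCB_0}(\mathbf{HP})$).
   Context: $\mathcal{N}=\omega^\omega$ is the Baire space. A qcb$_0$-space is a $T_0$ topological space which is a topological quotient of a countably based space; $\mathsf{QCB_0}$ is the category of qcb$_0$-spaces and continuous maps, which is cartesian closed, countably complete and countably co-complete. A representation of a space $X$ is a surjection $\delta$ from $\mathit{dom}(\delta)\subseteq\mathcal{N}$ onto $X$; it is admissible if it is continuous and every continuous $\nu\colon Z\to X$ with $Z\subseteq\mathcal{N}$ satisfies $\nu=\delta g$ for some continuous $g\colon Z\to\mathcal{N}$. $\mathit{EQ}(\delta)=\{(p,q)\in\mathcal{N}^2\mid p,q\in\mathit{dom}(\delta),\ \delta(p)=\delta(q)\}$. A family of pointclasses $\mathbf{\Gamma}$ assigns to each topological space $X$ a collection $\mathbf{\Gamma}(X)$ of subsets of $X$, closed under continuous preimages. Operations: $\mathbf{\Gamma}_c(X)$ = complements; $\mathbf{\Gamma}_\delta(X)$ = countable intersections; $\mathbf{\Gamma}_\exists(X)=\{\{x\mid\exists p\in\mathcal{N}.(p,x)\in A\}\mid A\in\mathbf{\Gamma}(\mathcal{N}\times X)\}$; composite subscripts applied left to right. Hyperprojective hierarchy: $\mathbf{\Sigma}^1_0(X)$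 = countable unions of differences of two open sets, $\mathbf{\Sigma}^1_{\alpha+1}=(\mathbf{\Sigma}^1_\alpha)_{c\exists}$, $\mathbf{\Sigma}^1_\lambda=(\mathbf{\Sigma}^1_{<\lambda})_{\delta\exists}$ for limit $\lambda<\omega_1$, where $\mathbf{\Sigma}^1_{<\lambda}(X)=\bigcup_{\alpha<\lambda}\mathbf{\Sigma}^1_\alpha(X)$. $\mathsf{QCB_0}(\mathbf{\Gamma})$ is the class of spaces having an admissible representation $\delta$ with $\mathit{EQ}(\delta)\in\mathbf{\Gamma}(\mathcal{N}^2)$. $\mathsf{QCB_0}(\mathbf{HP})$ is the full subcategory of $\mathsf{QCB_0}$ whose objects are the spaces in $\bigcup_{\alpha<\omega_1}\mathsf{QCB_0}(\mathbf{\Sigma}^1_\alpha)$ (hyperprojective qcb$_0$-spaces). *)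

(* Defs.v *)
From HB Require Import structures.
From mathcomp Require Import all_boot all_order.
From mathcomp Require Import all_classical.
From mathcomp Require Import wochoice.
From mathcomp Require Import topology.

Set Implicit Arguments.
Unset Strict Implicit.
Unset Printing Implicit Defensive.

Local Open Scope classical_set_scope.

Record category := Category {
  obj :> Type;
  hom : obj -> obj -> Type;
  idm : forall x, hom x x;
  compm : forall x y z, hom y z -> hom x y -> hom x z;
  comp_id_l : forall x y (f : hom x y), compm (idm y) f = f;
  comp_id_r : forall x y (f : hom x y), compm f (idm x) = f;
  comp_assoc : forall w x y z (h : hom y z) (g : hom x y) (f : hom w x),
    compm h (compm g f) = compm (compm h g) f }.

Arguments hom {c} _ _.
Arguments idm {c} x.
Arguments compm {c x y z} _ _.

Notation "g \oc f" := (compm g f) (at level 40, left associativity).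

Record functor (J C : category) := Functor {
  fobj :> J -> C;
  fmap : forall i j, hom i j -> hom (fobj i) (fobj j);
  fmap_id : forall i, fmap (idm i) = idm (fobj i);
  fmap_comp : forall i j k (g : hom j k) (f : hom i j),
    fmap (g \oc f) = fmap g \oc fmap f }.

Definition full_subcategory (C : category) (P : C -> Prop) : category :=
  @Category {x : C | P x} (fun x y => hom (sval x) (sval y))
    (fun x => idm (sval x)) (fun _ _ _ g f => g \oc f)
    (fun _ _ => @comp_id_l C _ _) (fun _ _ => @comp_id_r C _ _)
    (fun _ _ _ _ => @comp_assoc C _ _ _ _).

(* Injections into [nat] rather than the library's [countable], whose universe *)
(* is too small for the object type of a category such as [Top] below.        *)
Definition countable_category (J : category) : Prop :=
  (exists c : J -> nat, forall i j, c i = c j -> i = j) /\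
  forall i j : J, exists c : hom i j -> nat, forall f g, c f = c g -> f = g.

Section universal_properties.
Variable C : category.
Implicit Types x y z p q e l : C.

Definition is_terminal p : Prop := forall z, exists! u : hom z p, True.

Definition is_binary_product x y p (p1 : hom p x) (p2 : hom p y) : Prop :=
  forall q (q1 : hom q x) (q2 : hom q y),
    exists! u : hom q p, p1 \oc u = q1 /\ p2 \oc u = q2.

(* [e] is the exponential y^x, [p] a product e * x with projections [p1] and  *)
(* [p2], and [ev] the evaluation; [k] below is the morphism h * id_x.         *)
Definition is_exponential x y e p (p1 : hom p e) (p2 : hom p x)
    (ev : hom p y) : Prop :=
  is_binary_product p1 p2 /\
  forall z q (q1 : hom q z) (q2 : hom q x), is_binary_product q1 q2 ->
  forall g : hom q y, exists! h : hom z e,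
    exists k : hom q p, [/\ p1 \oc k = h \oc q1, p2 \oc k = q2 & ev \oc k = g].

Definition is_product (I : Type) (F : I -> C) p
    (pr : forall i, hom p (F i)) : Prop :=
  forall q (f : forall i, hom q (F i)),
    exists! u : hom q p, forall i, pr i \oc u = f i.

Definition is_coproduct (I : Type) (F : I -> C) p
    (inj : forall i, hom (F i) p) : Prop :=
  forall q (f : forall i, hom (F i) q),
    exists! u : hom p q, forall i, u \oc inj i = f i.

Definition is_equalizer x y (f g : hom x y) e (m : hom e x) : Prop :=
  f \oc m = g \oc m /\
  forall z (h : hom z x), f \oc h = g \oc h ->
    exists! u : hom z e, m \oc u = h.

Definition is_coequalizer x y (f g : hom x y) e (m : hom y e) : Prop :=
  m \oc f = m \oc g /\
  forall z (h : hom y z), h \oc f = h \oc g ->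
    exists! u : hom e z, u \oc m = h.

Definition is_cone (J : category) (F : functor J C) l
    (pr : forall j, hom l (F j)) : Prop :=
  forall (i j : J) (a : hom i j), fmap F a \oc pr i = pr j.

Definition is_limit (J : category) (F : functor J C) l
    (pr : forall j, hom l (F j)) : Prop :=
  is_cone pr /\
  forall q (f : forall j, hom q (F j)), is_cone f ->
    exists! u : hom q l, forall j, pr j \oc u = f j.

Definition is_cocone (J : category) (F : functor J C) l
    (inj : forall j, hom (F j) l) : Prop :=
  forall (i j : J) (a : hom i j), inj j \oc fmap F a = inj i.

Definition is_colimit (J : category) (F : functor J C) l
    (inj : forall j, hom (F j) l) : Prop :=
  is_cocone inj /\
  forall q (f : forall j, hom (F j) q), is_cocone f ->
    exists! u : hom l q, forall j, u \oc inj j = f j.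

Definition cartesian_closed : Prop :=
  [/\ exists p, is_terminal p,
      forall x y, exists p (p1 : hom p x) (p2 : hom p y),
        is_binary_product p1 p2
    & forall x y, exists e p (p1 : hom p e) (p2 : hom p x) (ev : hom p y),
        is_exponential p1 p2 ev].

Definition countably_complete : Prop :=
  forall (J : category) (F : functor J C), countable_category J ->
    exists l (pr : forall j, hom l (F j)), is_limit pr.

Definition countably_cocomplete : Prop :=
  forall (J : category) (F : functor J C), countable_category J ->
    exists l (inj : forall j, hom (F j) l), is_colimit inj.

End universal_properties.

(* Inheritance of constructions by a full subcategory [D] of [C]: for data in *)
(* [D] the [C]-construction exists, and every instance of it (it is unique    *)
(* only up to isomorphism) has its object in [D] and is the corresponding     *)
(* construction of the category [D].                                          *)

Section inheritance.
Variables (C : category) (P : C -> Prop).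
Let D := full_subcategory P.

Definition inherits_exponentials : Prop :=
  forall x y : D,
    (exists (e p : C) (p1 : hom p e) (p2 : hom p (sval x))
        (ev : hom p (sval y)), is_exponential p1 p2 ev) /\
    forall (e p : C) (p1 : hom p e) (p2 : hom p (sval x))
        (ev : hom p (sval y)), is_exponential p1 p2 ev ->
      exists (Pe : P e) (Pp : P p),
        @is_exponential D x y (exist P e Pe) (exist P p Pp) p1 p2 ev.

Definition inherits_countable_products : Prop :=
  forall (I : Type) (F : I -> D), countable [set: I] ->
    (exists (p : C) (pr : forall i, hom p (sval (F i))), is_product pr) /\
    forall (p : C) (pr : forall i, hom p (sval (F i))), is_product pr ->
      exists Pp : P p, @is_product D I F (exist P p Pp) pr.

Definition inherits_countable_coproducts : Prop :=
  forall (I : Type) (F : I -> D), countable [set: I] ->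
    (exists (p : C) (inj : forall i, hom (sval (F i)) p), is_coproduct inj) /\
    forall (p : C) (inj : forall i, hom (sval (F i)) p), is_coproduct inj ->
      exists Pp : P p, @is_coproduct D I F (exist P p Pp) inj.

Definition inherits_equalizers : Prop :=
  forall (x y : D) (f g : hom (sval x) (sval y)),
    (exists (e : C) (m : hom e (sval x)), is_equalizer f g m) /\
    forall (e : C) (m : hom e (sval x)), is_equalizer f g m ->
      exists Pe : P e, @is_equalizer D x y f g (exist P e Pe) m.

Definition inherits_coequalizers : Prop :=
  forall (x y : D) (f g : hom (sval x) (sval y)),
    (exists (e : C) (m : hom (sval y) e), is_coequalizer f g m) /\
    forall (e : C) (m : hom (sval y) e), is_coequalizer f g m ->
      exists Pe : P e, @is_coequalizer D x y f g (exist P e Pe) m.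

End inheritance.

Section topcat.
Implicit Types W X Y Z : topologicalType.

Definition top_id X : continuousType X X := [the continuousType X X of idfun].

Definition top_comp X Y Z (g : continuousType Y Z) (f : continuousType X Y) :
  continuousType X Z := [the continuousType X Z of g \o f].

Lemma top_comp_id_l X Y (f : continuousType X Y) : top_comp (top_id Y) f = f.
Proof. exact/continuousEP. Qed.

Lemma top_comp_id_r X Y (f : continuousType X Y) : top_comp f (top_id X) = f.
Proof. exact/continuousEP. Qed.

Lemma top_comp_assoc W X Y Z (h : continuousType Y Z) (g : continuousType X Y)
    (f : continuousType W X) :
  top_comp h (top_comp g f) = top_comp (top_comp h g) f.
Proof. exact/continuousEP. Qed.

End topcat.

Definition Top : category :=
  @Category topologicalType (fun X Y => continuousType X Y)
    top_id top_comp top_comp_id_l top_comp_id_r top_comp_assoc.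

Definition topological_quotient (B X : topologicalType) (f : B -> X) : Prop :=
  (forall x, exists b, f b = x) /\
  forall U : set X, open U <-> open (f @^-1` U).

Definition qcb0_space (X : topologicalType) : Prop :=
  kolmogorov_space X /\
  exists (B : topologicalType) (f : B -> X),
    @second_countable B /\ topological_quotient f.

Definition QCB0 : category := @full_subcategory Top qcb0_space.

Definition baire : Type := prod_topology (fun _ : nat => nat).
HB.instance Definition _ := Choice.on baire.
HB.instance Definition _ := Nbhs.on baire.
HB.instance Definition _ := Topological.on baire.

(* The domain, a set of points of Baire space, is used as a type through the  *)
(* coercion [set_type]; it then carries the subspace topology.                *)
Record representation (X : topologicalType) := Representation {
  rep_dom : set baire;
  rep_fun :> rep_dom -> X;
  rep_surj : forall x, exists p, rep_fun p = x }.

Definition admissible (X : topologicalType) (d : representation X) : Prop :=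
  continuous d /\
  forall (Z : set baire) (nu : Z -> X), continuous nu ->
    exists g : Z -> rep_dom d, continuous g /\ nu = d \o g.

Definition EQ (X : topologicalType) (d : representation X) :
    set (baire * baire) :=
  [set pq | exists p q : rep_dom d,
     [/\ pq.1 = set_val p, pq.2 = set_val q & d p = d q]].

Definition pointclass_family := forall X : topologicalType, set (set X).

Definition preimage_closed (G : pointclass_family) : Prop :=
  forall (X Y : topologicalType) (f : X -> Y), continuous f ->
  forall A : set Y, G Y A -> G X (f @^-1` A).

Definition pc_c (G : pointclass_family) : pointclass_family :=
  fun X => [set ~` A | A in G X].

Definition pc_delta (G : pointclass_family) : pointclass_family :=
  fun X => [set B | exists A : nat -> set X,
                      (forall n, G X (A n)) /\ B = \bigcap_n A n].

Definition pc_exists (G : pointclass_family) : pointclass_family :=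
  fun X => [set [set x | exists p : baire, A (p, x)]
           | A in G (baire * X)%type].

Definition QCB0_of (G : pointclass_family) (X : QCB0) : Prop :=
  exists d : representation (sval X),
    admissible d /\ G (baire * baire)%type (EQ d).

(* A countable ordinal is presented as a point of a countable well-ordered    *)
(* set: it is the order type of the set of the strict predecessors of that    *)
(* point, and every ordinal below omega_1 arises in this way. The order       *)
(* [cwo_le] is non-strict.                                                    *)

Record countable_wo := CountableWo {
  cwo_sort :> countType;
  cwo_le : rel cwo_sort;
  cwo_wo : well_order cwo_le }.

Section countable_ordinals.
Variable W : countable_wo.
Implicit Types a b c : W.

Definition cwo_lt b a : Prop := ~~ cwo_le a b.

Definition is_zero a : Prop := forall b, ~ cwo_lt b a.

Definition is_succ b a : Prop :=
  cwo_lt b a /\ forall c, cwo_lt c a -> cwo_le c b.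

Definition is_limit_ord a : Prop :=
  ~ is_zero a /\ forall b, ~ is_succ b a.

Lemma cwo_lt_wf : well_founded cwo_lt.
Proof.
move=> a; apply: contrapT => Na.
have [|m [[mA mlb] _]] := @cwo_wo W [pred x | `[< ~ Acc cwo_lt x >]].
  by exists a; apply/asboolP.
move: mA => /asboolP; apply; constructor => b; rewrite /cwo_lt => bm.
by apply: contrapT => Nb; move/negP: bm; apply; apply: mlb; apply/asboolP.
Qed.

Lemma is_succ_uniq a b b' : is_succ b a -> is_succ b' a -> b = b'.
Proof.
have wo : {in <= predT, well_order (@cwo_le W)}.
  by move=> A _; exact: cwo_wo.
have anti := @wo_chain_antisymmetric W (@cwo_le W) predT wo.
move=> [ba bmax] [b'a b'max]; apply: anti => //.
by rewrite b'max ?bmax.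
Qed.

End countable_ordinals.

Definition Sigma1_base : pointclass_family :=
  fun X => [set A | exists U V : nat -> set X,
    [/\ forall n, open (U n), forall n, open (V n)
      & A = \bigcup_n (U n `\` V n)]].

Definition Sigma1_step (W : countable_wo) (a : W)
    (rec : forall b, cwo_lt b a -> pointclass_family) : pointclass_family :=
  fun X => [set A |
    [\/ is_zero a /\ Sigma1_base A,
        exists b (ba : cwo_lt b a), is_succ b a /\ pc_exists (pc_c (rec b ba)) A
      | is_limit_ord a /\
        pc_exists (pc_delta (fun Y => [set B |
          exists b (ba : cwo_lt b a), rec b ba Y B])) A]].

Definition Sigma1 (W : countable_wo) : W -> pointclass_family :=
  Fix (@cwo_lt_wf W) (fun=> pointclass_family) (@Sigma1_step W).

Definition Sigma1_below (W : countable_wo) (a : W) : pointclass_family :=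
  fun X => \bigcup_(b in [set b | cwo_lt b a]) Sigma1 b (X := X).

Section Sigma1_equations.
Variable W : countable_wo.
Implicit Types a b : W.

Lemma Sigma1E a : Sigma1 a = Sigma1_step (fun b (_ : cwo_lt b a) => Sigma1 b).
Proof.
rewrite {1}/Sigma1 Fix_eq// => x f g fg; suff -> : f = g by [].
by apply: functional_extensionality_dep => y;
  apply: functional_extensionality_dep => h; exact: fg.
Qed.

Lemma Sigma1_zero a : is_zero a -> Sigma1 a = Sigma1_base.
Proof.
move=> a0; rewrite Sigma1E; apply: functional_extensionality_dep => X.
apply/seteqP; split => A.
  by move=> [[]//|[b [/a0]]//|[[]]//].
by move=> SA; constructor 1.
Qed.

Lemma Sigma1_succ a b : is_succ b a ->
  Sigma1 a = pc_exists (pc_c (Sigma1 b)).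
Proof.
move=> ba; rewrite Sigma1E; apply: functional_extensionality_dep => X.
apply/seteqP; split => A.
  move=> [[/(_ b) + _]|[c [ca [sca]]]|[[_ /(_ b)]]//]; first by case; case: ba.
  by rewrite (is_succ_uniq ba sca).
by move=> SA; constructor 2; exists b, ba.1.
Qed.

Lemma Sigma1_limit a : is_limit_ord a ->
  Sigma1 a = pc_exists (pc_delta (Sigma1_below a)).
Proof.
move=> la; rewrite Sigma1E; apply: functional_extensionality_dep => X.
have -> : Sigma1_below a = fun Y => [set B |
    exists b (ba : cwo_lt b a), Sigma1 b B].
  apply: functional_extensionality_dep => Y; apply/seteqP; split => B.
    by move=> [b ba SB]; exists b, ba.
  by move=> [b [ba SB]]; exists b.
apply/seteqP; split => A; last by move=> SA; constructor 3.
move=> [[za _]|[b [_ [sb _]]]|[]//]; first by case: la.1.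
by case: (la.2 b).
Qed.

End Sigma1_equations.

Lemma pc_c_preimage G : preimage_closed G -> preimage_closed (pc_c G).
Proof.
move=> Gc X Y f cf _ [A GA <-]; exists (f @^-1` A); first exact: Gc.
by rewrite preimage_setC.
Qed.

Lemma pc_delta_preimage G : preimage_closed G -> preimage_closed (pc_delta G).
Proof.
move=> Gc X Y f cf _ [A [GA ->]]; exists (fun n => f @^-1` A n).
by split=> [n|]; [exact: Gc | rewrite preimage_bigcap].
Qed.

Lemma pc_exists_preimage G : preimage_closed G -> preimage_closed (pc_exists G).
Proof.
move=> Gc X Y f cf _ [A GA <-].
exists ((fun px : baire * X => (px.1, f px.2)) @^-1` A) => //.
apply: Gc GA => px.
apply: (@cvg_pair _ _ _ _ (nbhs px.1) (nbhs (f px.2))).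
  exact: (@cvg_fst _ _ (nbhs px.1) (nbhs px.2)).
apply: (@cvg_comp _ _ _ snd f _ _ _ _ (cf _)).
exact: (@cvg_snd _ _ (nbhs px.1) (nbhs px.2)).
Qed.

Lemma Sigma1_preimage (W : countable_wo) (a : W) : preimage_closed (Sigma1 a).
Proof.
elim/(well_founded_ind (@cwo_lt_wf W)) : a => a IH.
have [a0|Na0] := pselect (is_zero a).
  rewrite Sigma1_zero// => X Y f /continuousP cf _ [U [V [oU oV ->]]].
  exists (fun n => f @^-1` U n), (fun n => f @^-1` V n).
  by split=> [n|n|]; [exact: cf|exact: cf|rewrite preimage_bigcup].
have [[b ba]|Ns] := pselect (exists b, is_succ b a).
  rewrite (Sigma1_succ ba).
  by apply/pc_exists_preimage/pc_c_preimage/IH; case: ba.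
rewrite Sigma1_limit; last by split=> // b ba; apply: Ns; exists b.
apply/pc_exists_preimage/pc_delta_preimage => X Y f cf A [b ba SA].
by exists b => //; exact: IH.
Qed.

Definition hyperprojective (X : QCB0) : Prop :=
  exists (W : countable_wo) (a : W), QCB0_of (Sigma1 a) X.

Definition QCB0_HP : category := full_subcategory hyperprojective.

(* Main.v *)
From HB Require Import structures.
From mathcomp Require Import all_boot all_order.
From mathcomp Require Import all_classical.
From mathcomp Require Import wochoice.
From mathcomp Require Import topology.
Require Import Defs.

(* Subsets of a space lying in some level of the hierarchy form a class closed
   under complement, countable unions and intersections, projection along Baire
   space and continuous preimages. An admissible representation reduces maps
   between qcb0-spaces to maps between subsets of Baire space, so every
   construction of QCB0 is given by an explicit set of names, whose equality
   relation is then a formula built with these operations. Limits are subspaces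
   of products and carry the final topology of the obvious names. Exponentials
   are named by Kleene associates; that evaluation stays continuous is proved
   along convergent sequences. A colimit [Q] of [Y] is the image of [Y] in
   [S^E], where [S] is the Sierpinski space and [E] the subspace of [S^Y]
   consisting of the open sets compatible with the diagram: [E] is an equalizer
   of exponentials, and the names of points in the image are a projection of a
   hyperprojective set. *)

Set Implicit Arguments.
Unset Strict Implicit.
Unset Printing Implicit Defensive.

Local Open Scope classical_set_scope.

(** * Hyperprojective sets *)

(** Countable products force the passage beyond the finite levels: the factors may sit at unbounded
    levels, taken in unrelated well-orders, and their equality relations are intersected at a limit
    level of a common sum. For co-equalizers the obvious names fail: a representation of [Y]
    followed by the quotient map is in general not admissible. The embedding into a function space
    over the Sierpinski space supplies admissible names, and it turns the identification of two
    points into a statement about all compatible open sets, that is, a quantifier over Baire space.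
    Inheritance concerns every instance of a construction, so one instance in the subcategory is
    combined with uniqueness up to isomorphism. *)

Section countable_wo_theory.
Variable W : countable_wo.
Implicit Types a b c : W.

Let wo : {in <= predT, well_order (@cwo_le W)}.
Proof. by move=> A _; exact: cwo_wo. Qed.

Lemma cwo_le_anti a b : cwo_le a b -> cwo_le b a -> a = b.
Proof. by move=> ab ba; apply: (wo_chain_antisymmetric wo) => //; apply/andP. Qed.

Lemma cwo_min (A : set W) : A !=set0 ->
  exists2 m, A m & forall a, A a -> cwo_le m a.
Proof.
move=> [a Aa]; have [|m [[mA mlb] _]] := @cwo_wo W [pred x | `[< A x >]].
  by exists a; apply/asboolP.
by exists m; [exact/asboolP | move=> b Ab; apply: mlb; apply/asboolP].
Qed.

Lemma cwo_succ a b : cwo_lt a b -> exists s, is_succ a s.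
Proof.
move=> ab; have [|s as_ smin] := @cwo_min [set c | cwo_lt a c]; first by exists b.
exists s; split=> // c cs; apply: contrapT => /negP ca.
by move: cs; rewrite /cwo_lt smin.
Qed.

End countable_wo_theory.

(** * Lexicographic sums of countable well-orders *)

Section ordinal_sum.
Variable W : nat -> countable_wo.

(** The added point [None] is a top: it lies above all summands and gives every point of the sum
    coming from some [W n] a successor. *)
Let T := option {n : nat & W n}.

Definition sum_le (x y : T) : bool :=
  match x, y with
  | _, None => true
  | None, Some _ => false
  | Some u, Some v => (tag u < tag v) ||
      (tag u == tag v) && cwo_le (tagged u) (tagged_as u v)
  end.

Lemma sum_le_wo : well_order sum_le.
Proof.
apply: antisymmetric_well_order => [|A [x0 Ax0]].
  move=> [[n a]|] [[m b]|] //= /andP[].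
  case: ltngtP => //= nm; subst m; rewrite !tagged_asE => ab ba.
  by rewrite (cwo_le_anti ab ba).
have [[u Au]|noA] := pselect (exists u, Some u \in A); last first.
  exists x0; split=> // -[u Au|_]; last by case: x0 {Ax0}.
  by exfalso; apply: noA; exists u.
have exn : exists n, `[< exists a : W n, Some (Tagged W a) \in A >].
  by exists (tag u); apply/asboolP; exists (tagged u); case: u Au.
case: (ex_minnP exn) => n /asboolP An nmin.
have [m Am mmin] := @cwo_min (W n) [set a | Some (Tagged W a) \in A] An.
exists (Some (Tagged W m)); split=> // -[[k b]|]//= Ab.
have: n <= k by apply: nmin; apply/asboolP; exists b.
case: ltngtP => //= nk _; subst k.
by rewrite tagged_asE; apply: mmin.
Qed.

Definition sum_wo : countable_wo := CountableWo sum_le_wo.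

Definition sum_in n (a : W n) : sum_wo := Some (Tagged W a).

Definition sum_top : sum_wo := None.

Lemma sum_in_lt n (a b : W n) : cwo_lt a b -> cwo_lt (sum_in a) (sum_in b).
Proof. by rewrite /cwo_lt /= ltnn eqxx /= tagged_asE. Qed.

Lemma sum_in_lt_top n (a : W n) : cwo_lt (sum_in a) sum_top.
Proof. by []. Qed.

Lemma sum_in_succ n (a b : W n) : is_succ a b -> is_succ (sum_in a) (sum_in b).
Proof.
move=> [ab amax]; split; first exact: sum_in_lt.
move=> [[k c]|]; rewrite /cwo_lt //=.
case: ltngtP => //= kn; subst k; rewrite !tagged_asE; exact: amax.
Qed.

(** A limit of [W n] has a point [b] of [W n] below it, so no point of an earlier summand can be its
    predecessor. The least point of a summand, by contrast, may stop being zero; [Sigma1_base_sub]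
    takes care of that case. *)
Lemma sum_in_limit n (a : W n) : is_limit_ord a -> is_limit_ord (sum_in a).
Proof.
move=> [a0 aS].
have [b ba] : exists b, cwo_lt b a.
  by apply: contrapT => H; apply: a0 => b ba; apply: H; exists b.
split=> [/(_ (sum_in b))|]; first by apply; exact: sum_in_lt.
move=> [[k c]|] [//+ cmax]; rewrite /cwo_lt /=.
case: (ltngtP n k) => //= nk.
  by have := cmax _ (sum_in_lt ba); rewrite /= ltnNge (ltnW nk) /= (gtn_eqF nk).
subst k; rewrite tagged_asE => ca; apply: (aS c); split=> // d da.
by have := cmax _ (sum_in_lt da); rewrite /= ltnn eqxx tagged_asE.
Qed.

Lemma sum_top_limit (a : forall n, W n) : is_limit_ord sum_top.
Proof.
split=> [/(_ (sum_in (a 0)))|]; first by apply; exact: sum_in_lt_top.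
move=> [[n b]|] [//_ bmax].
by have := bmax (sum_in (a n.+1)) isT; rewrite /= ltnNge leqnSn /= gtn_eqF.
Qed.

End ordinal_sum.

Lemma pc_exists_mono (G H : pointclass_family) :
  (forall X A, G X A -> H X A) ->
  forall (X : topologicalType) (A : set X), pc_exists G A -> pc_exists H A.
Proof. by move=> GH X _ [A GA <-]; exists A => //; exact: GH. Qed.

Lemma pc_c_mono (G H : pointclass_family) :
  (forall X A, G X A -> H X A) ->
  forall (X : topologicalType) (A : set X), pc_c G A -> pc_c H A.
Proof. by move=> GH X _ [A GA <-]; exists A => //; exact: GH. Qed.

Lemma pc_delta_mono (G H : pointclass_family) :
  (forall X A, G X A -> H X A) ->
  forall (X : topologicalType) (A : set X), pc_delta G A -> pc_delta H A.
Proof.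
by move=> GH X _ [A [GA ->]]; exists A; split=> // n; exact: GH.
Qed.

Lemma continuous_fstT (X Y : topologicalType) : continuous (@fst X Y).
Proof. by move=> xy; exact: (@cvg_fst _ _ (nbhs xy.1) (nbhs xy.2)). Qed.

Lemma continuous_sndT (X Y : topologicalType) : continuous (@snd X Y).
Proof. by move=> xy; exact: (@cvg_snd _ _ (nbhs xy.1) (nbhs xy.2)). Qed.

Lemma continuous_pairT (Z X Y : topologicalType) (f : Z -> X) (g : Z -> Y) :
  continuous f -> continuous g -> continuous (fun z => (f z, g z)).
Proof. by move=> cf cg z; apply: cvg_pair; [exact: cf | exact: cg]. Qed.

Lemma pc_exists_dummy (G : pointclass_family) : Defs.preimage_closed G ->
  forall (X : topologicalType) (A : set X), G X A -> pc_exists G A.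
Proof.
move=> Gc X A GA; exists (@snd baire X @^-1` A).
  by apply: Gc GA; exact: continuous_sndT.
by apply/seteqP; split=> [x []//|x Ax]; exists (fun=> 0).
Qed.

(** A countable union of differences of open sets is the projection of a set whose complement is
    again such a union. This passes the inclusion through successors; a limit takes it from any
    lower level. *)
Lemma Sigma1_base_sub (W : countable_wo) (a : W) (X : topologicalType)
    (A : set X) :
  Sigma1_base A -> Sigma1 a A.
Proof.
elim/(well_founded_ind (@cwo_lt_wf W)) : a X A => a IH X A SA.
have [a0|Na0] := pselect (is_zero a); first by rewrite Sigma1_zero.
have [[b ba]|Ns] := pselect (exists b, is_succ b a).
  rewrite (Sigma1_succ ba); case: SA => U [V [oU oV ->]].
  (* The union over [n] becomes a projection, with [n] read as the first value of the Baire
     point. *)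
  exists ([set u : baire * X | (U (u.1 0) `\` V (u.1 0)) u.2]); last first.
    apply/seteqP; split=> [x [p UV]|x [n _ UV]]; first by exists (p 0).
    by exists (fun=> n).
  exists (~` [set u : baire * X | (U (u.1 0) `\` V (u.1 0)) u.2]); last first.
    by rewrite setCK.
  apply: IH; first by case: ba.
  have oS (O : nat -> set X) : (forall n, open (O n)) ->
      open [set u : baire * X | O (u.1 0) u.2].
    move=> oO; have -> : [set u : baire * X | O (u.1 0) u.2] =
        \bigcup_n ((fun u : baire * X => u.1 0) @^-1` [set n] `&` snd @^-1` O n).
      by apply/seteqP; split=> [u Ou|u [n _ [/= <-]]//]; exists (u.1 0).
    apply: bigcup_open => n _; apply: openI; last first.
      by apply: open_comp (oO n) => u _; exact: continuous_sndT.
    apply: open_comp (discrete_open _) => u _.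
    apply: (@continuous_comp _ _ _ fst (fun p : baire => p 0)).
      exact: continuous_fstT.
    exact: (@proj_continuous nat (fun=> nat) 0).
  (* The complement of a difference of open sets is the complement of the first, [setT] minus an
     open set, together with the second. *)
  exists (fun n => if n is 0 then setT else [set u | V (u.1 0) u.2]).
  exists (fun n => if n is 0 then [set u | U (u.1 0) u.2] else set0).
  split=> [[|n]|[|n]|]; try exact: oS; try exact: openT; try exact: open0.
  apply/seteqP; split=> [u /= /not_andP[nU|nV]|u [[|n] _ [/= H1 H2] []]//].
    by exists 0.
  by exists 1 => //; split => //; exact: contrapT.
have la : is_limit_ord a by split=> // b ba; apply: Ns; exists b.
rewrite Sigma1_limit//.
have [b ba] : exists b, cwo_lt b a.
  by apply: contrapT => H; apply: Na0 => b ba; apply: H; exists b.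
apply: pc_exists_dummy.
  apply: pc_delta_preimage => Y Z f cf B [c ca SB].
  by exists c => //; apply: Sigma1_preimage SB.
exists (fun=> A); split=> [_|]; last by rewrite bigcap_const//; exists 0.
by exists b => //; exact: IH.
Qed.

(* Strict monotonicity of [h] alone would also do, but only through the
   monotonicity of the hierarchy; since [h] preserves successors and limits, the
   comparison is a direct induction. *)
Lemma Sigma1_embed (W W' : countable_wo) (h : W -> W') :
  (forall a b, cwo_lt a b -> cwo_lt (h a) (h b)) ->
  (forall a b, is_succ a b -> is_succ (h a) (h b)) ->
  (forall a, is_limit_ord a -> is_limit_ord (h a)) ->
  forall a (X : topologicalType) (A : set X), Sigma1 a A -> Sigma1 (h a) A.
Proof.
move=> hlt hsucc hlim a.
elim/(well_founded_ind (@cwo_lt_wf W)) : a => a IH X A.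
have [a0|Na0] := pselect (is_zero a).
  by rewrite Sigma1_zero//; exact: Sigma1_base_sub.
have [[b ba]|Ns] := pselect (exists b, is_succ b a).
  rewrite (Sigma1_succ ba) (Sigma1_succ (hsucc _ _ ba)).
  by apply/pc_exists_mono/pc_c_mono/IH; case: ba.
have la : is_limit_ord a by split=> // b ba; apply: Ns; exists b.
rewrite !Sigma1_limit//; last exact: hlim.
apply/pc_exists_mono/pc_delta_mono => Y B [b ba SB].
by exists (h b); [exact: hlt | exact: IH].
Qed.

Definition hp (X : topologicalType) (A : set X) : Prop :=
  exists (W : countable_wo) (a : W), Sigma1 a A.

Lemma Sigma1_sum_in (W : nat -> countable_wo) n (a : W n)
    (X : topologicalType) (A : set X) :
  Sigma1 a A -> Sigma1 (sum_in a) A.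
Proof.
apply: Sigma1_embed => *; [exact: sum_in_lt | exact: sum_in_succ
  | exact: sum_in_limit].
Qed.

Lemma hp_preimage (X Y : topologicalType) (f : X -> Y) (A : set Y) :
  continuous f -> hp A -> hp (f @^-1` A).
Proof. by move=> cf [W [a SA]]; exists W, a; exact: Sigma1_preimage SA. Qed.

(** The point [a] may be maximal in [W]; in the sum it lies below the top and therefore has a
    successor. *)
Lemma hp_succ (X : topologicalType) (A : set X) (W : countable_wo) (a : W) :
  Sigma1 a A ->
  exists (W' : countable_wo) (b s : W'), is_succ b s /\ Sigma1 b A.
Proof.
move=> SA; pose b : sum_wo (fun=> W) := sum_in (n:=0) a.
have [s bs] := cwo_succ (sum_in_lt_top (W:=fun=> W) (n:=0) a).
by exists (sum_wo (fun=> W)), b, s; split=> //; exact: Sigma1_sum_in.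
Qed.

Lemma hpC (X : topologicalType) (A : set X) : hp A -> hp (~` A).
Proof.
move=> [W [a /hp_succ[W' [b [s [bs SA]]]]]]; exists W', s.
rewrite (Sigma1_succ bs); apply: pc_exists_dummy; last by exists A.
by apply: pc_c_preimage; exact: Sigma1_preimage.
Qed.

(** A successor level projects complements, so the argument starts from a level of the complement of
    [A]. *)
Lemma hp_ex (X : topologicalType) (A : set (baire * X)) :
  hp A -> hp [set x | exists p, A (p, x)].
Proof.
move=> /hpC [W [a /hp_succ[W' [b [s [bs SA]]]]]]; exists W', s.
by rewrite (Sigma1_succ bs); exists A => //; exists (~` A); rewrite ?setCK.
Qed.

Lemma hp_open (X : topologicalType) (A : set X) : open A -> hp A.
Proof.
move=> oA.
have wo1 : well_order (fun _ _ : unit => true).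
  by apply: antisymmetric_well_order => [[] []//|B [[] Bx]]; exists tt; split.
exists (CountableWo wo1), tt; apply: Sigma1_base_sub.
exists (fun=> A), (fun=> set0); split=> // [_|]; first exact: open0.
by rewrite setD0 bigcup_const//; exists 0.
Qed.

(** The top of the sum of all the well-orders involved is a limit above the levels of all the
    [A n]. *)
Lemma hp_bigcap (X : topologicalType) (A : nat -> set X) :
  (forall n, hp (A n)) -> hp (\bigcap_n A n).
Proof.
move=> hA.
have /choice[Wa SA] : forall n, exists Wa : {W : countable_wo & W},
    Sigma1 (projT2 Wa) (A n).
  by move=> n; have [W [a SA]] := hA n; exists (existT _ W a).
pose W n := projT1 (Wa n); pose a n : W n := projT2 (Wa n).
exists (sum_wo W), (sum_top W); rewrite (Sigma1_limit (sum_top_limit a)).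
apply: pc_exists_dummy.
  apply: pc_delta_preimage => Y Z f cf B [c ca SB].
  by exists c => //; apply: Sigma1_preimage SB.
exists A; split=> // n; exists (sum_in (a n)); first exact: sum_in_lt_top.
exact: (Sigma1_sum_in (SA n)).
Qed.

Lemma hp_bigcup (X : topologicalType) (A : nat -> set X) :
  (forall n, hp (A n)) -> hp (\bigcup_n A n).
Proof.
move=> hA; rewrite -[X in hp X]setCK setC_bigcup.
by apply: hpC; apply: hp_bigcap => n; exact: hpC.
Qed.

(** * Baire space *)

Definition agree n (p q : baire) : Prop := forall i, i < n -> p i = q i.

Lemma agreexx n p : agree n p p.
Proof. by []. Qed.

Lemma agree_sym n p q : agree n p q -> agree n q p.
Proof. by move=> pq i /pq. Qed.

Lemma agree_trans n p q r : agree n p q -> agree n q r -> agree n p r.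
Proof. by move=> pq qr i ni; rewrite pq// qr. Qed.

Lemma agreeW m n p q : m <= n -> agree n p q -> agree m p q.
Proof. by move=> mn pq i im; apply: pq; exact: leq_trans mn. Qed.

(** Moduli of continuity are obtained one value at a time; this merges those of the first [n]
    values. *)
Lemma uniform_bound (P : nat -> nat -> Prop) n :
  (forall i m m', m <= m' -> P i m -> P i m') ->
  (forall i, i < n -> exists m, P i m) -> exists m, forall i, i < n -> P i m.
Proof.
move=> Pmon; elim: n => [_|n IH H]; first by exists 0.
have [m1 Hm1] := IH (fun i ni => H i (ltnW ni)).
have [m2 Hm2] := H n (ltnSn n).
exists (maxn m1 m2) => i; rewrite ltnS leq_eqVlt => /predU1P[->|/Hm1].
  by apply: Pmon Hm2; rewrite leq_maxr.
by apply: Pmon; rewrite leq_maxl.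
Qed.

Lemma agree_open n (p : baire) : open [set q | agree n p q].
Proof.
elim: n => [|n IH].
  by rewrite (_ : mkset _ = setT); [exact: openT | apply/seteqP; split].
rewrite (_ : mkset _ = [set q | agree n p q] `&`
    (fun q : baire => q n) @^-1` [set p n]).
  apply: openI IH _; apply: open_comp (discrete_open _) => q _.
  exact: (@proj_continuous nat (fun=> nat) n).
apply/seteqP; split=> [q pq|q [pq qn] i].
  by split=> [i ni|/=]; [apply: pq; exact: ltnW | rewrite pq].
by rewrite ltnS leq_eqVlt => /predU1P[->|/pq].
Qed.

(** Convergence in the product topology is tested one coordinate at a time, and the cylinder of
    length [i.+1] fixes coordinate [i]. Hence every neighbourhood of [p] contains a cylinder. *)
Lemma agree_cvg (p : baire) :
  filter_from setT (fun n => [set q | agree n p q]) --> p.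
Proof.
have FF : Filter (filter_from setT (fun n => [set q | agree n p q])).
  apply: filter_from_filter; first by exists 0.
  move=> m n _ _; exists (maxn m n) => // q pq.
  by split; apply: agreeW pq; rewrite ?leq_maxl ?leq_maxr.
apply/cvg_sup => i; apply/cvg_image.
  by apply/seteqP; split=> // n _; exists (fun=> n).
move=> A Ap; exists ((fun q : baire => q i) @^-1` A); last first.
  by apply/seteqP; split=> [n [q /= Aq <-]//|n An]; exists (fun=> n).
exists i.+1 => // q /(_ i (ltnSn i)) /= <-.
exact: nbhs_singleton Ap.
Qed.

Lemma baire_openP (U : set baire) :
  open U <-> forall p, U p -> exists n, forall q, agree n p q -> U q.
Proof.
split=> [oU p Up|H].
  have [n _ sU] := agree_cvg (open_nbhs_nbhs (conj oU Up)).
  by exists n => q /sU.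
rewrite openE => p /H [n nU]; apply: (filterS nU).
by apply: open_nbhs_nbhs; split; [exact: agree_open | exact: agreexx].
Qed.

Lemma baire_sub_openP (Z : set baire) (V : set Z) : open V <->
  forall p : Z, V p -> exists n, forall q : Z,
    agree n (set_val p) (set_val q) -> V q.
Proof.
split=> [[U /baire_openP oU <-] p /= /oU [n nU]|H].
  by exists n => q; exact: nU.
exists [set q | exists2 p : Z, V p & exists2 n,
    (forall q : Z, agree n (set_val p) (set_val q) -> V q) &
    agree n (set_val p) q].
  apply/baire_openP => q [p Vp [n nV pq]]; exists n => r qr.
  by exists p => //; exists n => //; exact: agree_trans qr.
apply/seteqP; split=> [q /= [p Vp [n nV /nV]]//|q Vq].
by have [n nV] := H q Vq; exists q => //; exists n.
Qed.

Definition cts (f : baire -> baire) : Prop :=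
  forall p j, exists m, forall q, agree m p q -> f p j = f q j.

Lemma cts_agree f : cts f ->
  forall p n, exists m, forall q, agree m p q -> agree n (f p) (f q).
Proof.
move=> cf p n.
have [|i _|m Hm] := @uniform_bound
  (fun i m => forall q, agree m p q -> f p i = f q i) n.
- by move=> i m m' mm' H q /(agreeW mm')/H.
- exact: cf.
by exists m => q pq i ni; exact: Hm.
Qed.

Lemma cts_continuous f : cts f -> continuous f.
Proof.
move=> cf; apply/continuousP => U /baire_openP oU; apply/baire_openP => p /oU.
move=> [n nU]; have [m Hm] := cts_agree cf p n.
by exists m => q /Hm /nU.
Qed.

Lemma cts_id : cts id.
Proof. by move=> p j; exists j.+1 => q; apply. Qed.

Lemma cts_comp f g : cts f -> cts g -> cts (fun p => f (g p)).
Proof.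
move=> cf cg p j; have [n Hn] := cf (g p) j.
by have [m Hm] := cts_agree cg p n; exists m => q /Hm /Hn.
Qed.

Lemma cts_reindex (h : nat -> nat) : cts (fun p n => p (h n)).
Proof. by move=> p j; exists (h j).+1 => q; apply. Qed.

Definition prl (p : baire) : baire := fun n => p n.*2.
Definition prr (p : baire) : baire := fun n => p n.*2.+1.
Definition pr2 (p q : baire) : baire :=
  fun n => if odd n then q n./2 else p n./2.

Lemma pr2l p q : prl (pr2 p q) = p.
Proof. by apply: funext => n; rewrite /prl /pr2 odd_double doubleK. Qed.

Lemma pr2r p q : prr (pr2 p q) = q.
Proof. by apply: funext => n; rewrite /prr /pr2 /= odd_double /= uphalf_double. Qed.

Lemma cts_prl f : cts f -> cts (fun p => prl (f p)).
Proof. by apply: cts_comp; exact: cts_reindex. Qed.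

Lemma cts_prr f : cts f -> cts (fun p => prr (f p)).
Proof. by apply: cts_comp; exact: cts_reindex. Qed.

Lemma cts_pr2 f g : cts f -> cts g -> cts (fun p => pr2 (f p) (g p)).
Proof.
move=> cf cg p j; rewrite /pr2; case: (odd j); [exact: cg | exact: cf].
Qed.

Lemma agree_prl n p q : agree n.*2 p q -> agree n (prl p) (prl q).
Proof. by move=> pq i ni; apply: pq; rewrite ltn_double. Qed.

Lemma agree_prr n p q : agree n.*2 p q -> agree n (prr p) (prr q).
Proof. by move=> pq i ni; apply: pq; rewrite ltn_Sdouble. Qed.

Lemma agree_pr2 n p q p' q' : agree n p p' -> agree n q q' ->
  agree n (pr2 p q) (pr2 p' q').
Proof.
move=> pp qq i ni; rewrite /pr2.
have ni2 : i./2 < n by apply: leq_ltn_trans ni; rewrite -divn2 leq_div.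
by case: ifP => _; [exact: qq | exact: pp].
Qed.

Definition prn (p : baire) (k : nat) : baire := fun n => p (pickle (k, n)).
Definition tup (f : nat -> baire) : baire :=
  fun m => if unpickle m is Some (k, n) then f k n else 0.

Lemma tupK f k : prn (tup f) k = f k.
Proof. by apply: funext => n; rewrite /prn /tup pickleK. Qed.

Lemma cts_prn k : cts (fun p => prn p k).
Proof. exact: cts_reindex. Qed.

Definition bcons (k : nat) (p : baire) : baire := fun n => if n is m.+1 then p m else k.
Definition btail (p : baire) : baire := fun n => p n.+1.

Lemma cts_btail : cts btail.
Proof. exact: cts_reindex. Qed.

(** Relations are coded as sets of a single interleaved point, so that nested quantifiers only ever
    involve continuous self-maps of Baire space. *)
Definition hp2 (R : baire -> baire -> Prop) : Prop :=
  hp [set u | R (prl u) (prr u)].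

Lemma hp_ext (X : topologicalType) (A B : set X) :
  (forall x, A x <-> B x) -> hp A -> hp B.
Proof. by move=> AB; rewrite (_ : A = B)//; apply/seteqP; split=> x /AB. Qed.

Lemma hp_comp f (A : set baire) : cts f -> hp A -> hp [set u | A (f u)].
Proof. by move=> /cts_continuous; exact: hp_preimage. Qed.

Lemma hp2_comp R f g : cts f -> cts g -> hp2 R -> hp [set u | R (f u) (g u)].
Proof.
move=> cf cg /(hp_comp (cts_pr2 cf cg)).
by apply: hp_ext => u /=; rewrite pr2l pr2r.
Qed.

Lemma hp_all_nat (X : topologicalType) (A : nat -> set X) :
  (forall n, hp (A n)) -> hp [set x | forall n, A n x].
Proof.
by move=> /hp_bigcap; apply: hp_ext => x; split=> [H n|H n _]; exact: H.
Qed.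

Lemma hp_ex_nat (X : topologicalType) (A : nat -> set X) :
  (forall n, hp (A n)) -> hp [set x | exists n, A n x].
Proof. by move=> /hp_bigcup; apply: hp_ext => x; split=> [[n]|[n]]; exists n. Qed.

Lemma hp_and (X : topologicalType) (A B : set X) :
  hp A -> hp B -> hp [set x | A x /\ B x].
Proof.
move=> hA hB; have : forall n, hp (if n is 0 then A else B) by case.
move=> /hp_all_nat; apply: hp_ext => x; split=> [H|[Ax Bx] []//].
by split; [exact: (H 0) | exact: (H 1)].
Qed.

Lemma hp_imp (X : topologicalType) (A B : set X) :
  hp A -> hp B -> hp [set x | A x -> B x].
Proof.
move=> hA /hpC hB; have /hpC := hp_and hA hB.
apply: hp_ext => x /=; split=> [H Ax|H [Ax]]; last by apply; exact: H.
by apply: contrapT => nB; exact: H.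
Qed.

Lemma hp_const (X : topologicalType) (P : Prop) : hp [set _ : X | P].
Proof.
apply: hp_open; have [p|np] := pselect P.
  by rewrite (_ : mkset _ = setT); [exact: openT | apply/seteqP; split].
by rewrite (_ : mkset _ = set0); [exact: open0 | apply/seteqP; split].
Qed.

Lemma hp_all (X : topologicalType) (I : Type) (c : I -> nat) (A : I -> set X) :
  injective c -> (forall i, hp (A i)) -> hp [set x | forall i, A i x].
Proof.
move=> ci hA; have : forall n, hp [set x | forall i, c i = n -> A i x].
  move=> n; have [[i <-]|H] := pselect (exists i, c i = n).
    by apply: hp_ext (hA i) => x; split=> [Ax j /ci ->//|]; exact.
  apply: hp_ext (hp_const _ True) => x; split=> // _ i ci'.
  by exfalso; apply: H; exists i.
by move=> /hp_all_nat; apply: hp_ext => x; split=> [H i|H n i _]; [exact: (H (c i))|].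
Qed.

Lemma hp_exists (X : topologicalType) (I : Type) (c : I -> nat) (A : I -> set X) :
  injective c -> (forall i, hp (A i)) -> hp [set x | exists i, A i x].
Proof.
move=> ci hA; have /(hp_all ci)/hpC : forall i, hp (~` A i) by move=> i; exact: hpC.
by apply: hp_ext => x /=; rewrite -existsNP; split=> [[i /contrapT]|[i Ai]]; exists i.
Qed.

Lemma hp_exb R : hp2 R -> hp [set u | exists q, R u q].
Proof.
move=> hR; apply: (@hp_ex _ [set w : baire * baire | R w.2 w.1]).
have : continuous (fun w : baire * baire => pr2 w.2 w.1).
  apply/continuousP => U /baire_openP oU; rewrite openE => -[p q] /= /oU [n nU].
  exists ([set p' | agree n p p'], [set q' | agree n q q']).
    by split; apply: open_nbhs_nbhs; split; [exact: agree_open | exact: agreexx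
      | exact: agree_open | exact: agreexx].
  by move=> [p' q'] [/= pp qq]; apply: nU; exact: agree_pr2.
by move=> /hp_preimage/(_ hR); apply: hp_ext => -[p q] /=; rewrite pr2l pr2r.
Qed.

Lemma hp_allb R : hp2 R -> hp [set u | forall q, R u q].
Proof.
move=> hR; have /hpC : hp [set u | exists q, ~ R u q].
  by apply: hp_exb; exact: hpC hR.
apply: hp_ext => u /=; split=> [H q|H [q]]; last exact.
by apply: contrapT => nR; apply: H; exists q.
Qed.

Lemma hp_local (A : set baire) :
  (forall p, A p -> exists n, forall q, agree n p q -> A q) -> hp A.
Proof. by move=> H; apply: hp_open; exact/baire_openP. Qed.

Lemma hp2_pairs (E : set (baire * baire)) :
  hp E <-> hp2 (fun p q => E (p, q)).
Proof.
split=> hE.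
  apply: (@hp_preimage _ _ (fun u : baire => (prl u, prr u)) E) => //.
  by apply: continuous_pairT; apply: cts_continuous;
    [exact: (cts_prl cts_id) | exact: (cts_prr cts_id)].
have : continuous (fun w : baire * baire => pr2 w.1 w.2).
  apply/continuousP => U /baire_openP oU; rewrite openE => -[p q] /= /oU [n nU].
  exists ([set p' | agree n p p'], [set q' | agree n q q']).
    by split; apply: open_nbhs_nbhs; split; [exact: agree_open | exact: agreexx
      | exact: agree_open | exact: agreexx].
  by move=> [p' q'] [/= pp qq]; apply: nU; exact: agree_pr2.
by move=> /hp_preimage/(_ hE); apply: hp_ext => -[p q] /=; rewrite pr2l pr2r.
Qed.

(** * Kleene application *)

Definition code n (p : baire) m : nat :=
  pickle ((n, mkseq p m) : nat * seq nat).

Lemma mkseq_agree m (p q : baire) : agree m p q <-> mkseq p m = mkseq q m.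
Proof.
split=> [pq|pq i im].
  by apply/eq_in_map => i; rewrite mem_iota => /andP[_]; exact: pq.
by have := congr1 (fun s => nth 0 s i) pq; rewrite !nth_mkseq.
Qed.

Lemma code_agree n p q m : agree m p q -> code n p m = code n q m.
Proof.
by move=> /mkseq_agree pq; rewrite /code pq.
Qed.

(* Kleene application: [r] maps the prefixes of [p] to the values of [q], [0]
   meaning that a longer prefix must be read. *)
Definition app (r p q : baire) : Prop := forall n, exists m,
  r (code n p m) = (q n).+1 /\ forall m', m' < m -> r (code n p m') = 0.

(** The value [q n] is settled by the first nonzero answer of [r]. It depends on the part of [p]
    read up to then and on [r] at the finitely many codes queried, which [b] bounds. *)
Lemma app_cont r p q : app r p q -> forall k, exists m, forall r' p' q',
  agree m r r' -> agree m p p' -> app r' p' q' -> agree k q q'.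
Proof.
move=> rpq k; have [|n _|m Hm] := @uniform_bound
  (fun n m => forall r' p' q', agree m r r' -> agree m p p' ->
    app r' p' q' -> q n = q' n) k.
- by move=> i m m' mm' H r' p' q' /(agreeW mm') rr /(agreeW mm'); exact: H.
- have [m [rm rm0]] := rpq n.
  have [|i _|b Hb] := @uniform_bound (fun i b => code n p i < b) m.+1.
  - by move=> i b b' bb' ib; exact: leq_trans ib bb'.
  - by exists (code n p i).+1.
  exists (maxn b m) => r' p' q' rr pp r'p'q'.
  have e i : i <= m -> r' (code n p' i) = r (code n p i).
    move=> im; rewrite -(@code_agree n p p'); last first.
      by apply: agreeW pp; rewrite leq_max im orbT.
    by rewrite rr// leq_max Hb// ltnS.
  have [m' [r'm r'm0]] := r'p'q' n.
  have [mm|mm|mm] := ltngtP m m'.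
  - by have := r'm0 _ mm; rewrite e// rm.
  - by move: r'm; rewrite e ?(ltnW mm)// rm0.
  - by subst m'; move: r'm; rewrite e// rm => -[].
by exists m => r' p' q' rr pp H i ik; exact: (Hm i ik r' p' q').
Qed.

Lemma app_fun r p q q' : app r p q -> app r p q' -> q = q'.
Proof.
move=> H H'; apply: funext => n; have [m Hm] := app_cont H n.+1.
exact: (Hm r p q').
Qed.

(** For fixed [n] and [m] the condition in [app] is open, so the whole set is a countable
    intersection of open sets. *)
Lemma hp_app f g h : cts f -> cts g -> cts h ->
  hp [set u | app (f u) (g u) (h u)].
Proof.
move=> cf cg ch; apply: hp_all_nat => n; apply: hp_ex_nat => m.
apply: hp_local => u [fm fm0].
have [a Ha] := cts_agree cg u m.
have [b Hb] := ch u n.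
have [|i _|c Hc] := @uniform_bound (fun i c => forall v, agree c u v ->
    f u (code n (g u) i) = f v (code n (g u) i)) m.+1.
- by move=> i k k' kk' H v /(agreeW kk'); exact: H.
- exact: cf.
exists (maxn a (maxn b c)) => v uv.
have e i : i <= m -> f v (code n (g v) i) = f u (code n (g u) i).
  move=> im; rewrite -(@code_agree n (g u) (g v)); last first.
    by apply: agreeW im _; apply: Ha; apply: agreeW uv; rewrite leq_maxl.
  by apply/esym/Hc => //; apply: agreeW uv; rewrite !leq_max leqnn !orbT.
split=> [|m' mm']; last by rewrite e ?(ltnW mm')// fm0.
by rewrite e// fm (Hb v)//; apply: agreeW uv; rewrite !leq_max leqnn orbT.
Qed.

(** The associate [c z] answers a query about a prefix [w] as soon as [w] and the prefix of [z] of
    the same length determine the value of [G] on [Z]. Reading no more of [z] than that makes [c]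
    continuous and total. *)
Lemma curry_app (Z : baire -> baire -> Prop) (G : baire -> baire -> baire) :
  (forall z p, Z z p -> forall n, exists m, forall z' p', Z z' p' ->
    agree m z z' -> agree m p p' -> G z p n = G z' p' n) ->
  exists2 c, cts c & forall z p, Z z p -> app (c z) p (G z p).
Proof.
move=> cG.
pose P z n (w : seq nat) := [set v | forall z' p', Z z' p' ->
  agree (size w) z z' -> mkseq p' (size w) = w -> G z' p' n = v].
pose c (z : baire) : baire := fun k =>
  if unpickle k is Some (n, w) then
    if `[< P z n w !=set0 >] then (xget 0 (P z n w)).+1 else 0
  else 0.
have cE z n (p : baire) m : c z (code n p m) =
    if `[< P z n (mkseq p m) !=set0 >] then (xget 0 (P z n (mkseq p m))).+1 else 0.
  by rewrite /c pickleK.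
exists c => [z k|z p Zzp n].
  rewrite /c; case: unpickle => [[n w]|]; last by exists 0.
  exists (size w) => z' zz'; suff -> : P z n w = P z' n w by [].
  apply/seteqP; split=> v Pv z'' p' Z' zz; apply: Pv => //.
    exact: agree_trans zz.
  by apply: agree_trans zz; exact: agree_sym.
(* The least such [m] is the first prefix length with a nonzero answer, as [app] requires. *)
have exm : exists m, `[< P z n (mkseq p m) !=set0 >].
  have [m Hm] := cG z p Zzp n; exists m; apply/asboolP; exists (G z p n).
  move=> z' p' Z'; rewrite size_mkseq => zz /mkseq_agree/agree_sym pp; exact/esym/Hm.
case: (ex_minnP exm) => m Pm mmin; exists m; split=> [|m' mm'].
  rewrite cE Pm; congr S.
  move/asboolP: Pm => [v Pv].
  by rewrite -(xgetI 0 Pv z p)// size_mkseq.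
rewrite cE; case: ifPn => // /mmin; by rewrite leqNgt mm'.
Qed.

(** * Names of points and admissible representations *)

(* Partial multi-valued maps from Baire space are handled as relations:
   [M p x] means that [p] is a name of [x]. *)
Definition rel_open (X : Type) (M : baire -> X -> Prop) (U : set X) : Prop :=
  forall p x, M p x -> U x -> exists n, forall q y, agree n p q -> M q y -> U y.

Definition rel_map (X Y : Type) (f : X -> Y) (M : baire -> X -> Prop) :
  baire -> Y -> Prop := fun p y => exists2 x, M p x & f x = y.

Definition cont_rel (X : topologicalType) (M : baire -> X -> Prop) : Prop :=
  forall U : set X, open U -> rel_open M U.

(** Continuity of [g] is relative to the domain of [M], since a continuous map on a subspace of
    Baire space need not extend continuously. *)
Definition lifts (X : Type) (N M : baire -> X -> Prop) : Prop :=
  exists g : baire -> baire, (forall p x, M p x -> N (g p) x) /\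
    forall p x j, M p x ->
      exists m, forall q y, M q y -> agree m p q -> g p j = g q j.

Definition quot_rel (X : topologicalType) (M : baire -> X -> Prop) : Prop :=
  (forall x, exists p, M p x) /\ forall U : set X, open U <-> rel_open M U.

Definition same_name (X : Type) (N : baire -> X -> Prop) (p q : baire) : Prop :=
  exists x, N p x /\ N q x.

(** The relational form of an admissible representation with hyperprojective equality. The quotient
    clause, a consequence of admissibility on a qcb0-space, lets continuity of maps out of [X] be
    tested on names. *)
Record hp_naming (X : topologicalType) (N : baire -> X -> Prop) : Prop := {
  hpn_quot : quot_rel N;
  hpn_adm : forall M, cont_rel M -> lifts N M;
  hpn_hp : hp2 (same_name N) }.

Definition t0 (X : topologicalType) : Prop :=
  forall x y : X, (forall U : set X, open U -> U x <-> U y) -> x = y.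

Lemma t0P (X : topologicalType) : kolmogorov_space X <-> t0 X.
Proof.
split=> [kX x y xy|tX x y].
  apply: contrapT => /eqP /kX[A [[]|[]]]; rewrite !inE/= nbhsE => -[U [oU Ux] UA].
    by move=> nAy; apply/nAy/UA/(xy U oU).
  by move=> nAx; apply/nAx/UA/(xy U oU).
move/eqP=> xy; apply: contrapT => H; apply: xy; apply: tX => U oU.
have Hn a b : U a -> ~ U b -> (U \in nbhs a) /\ (b \in ~` U).
  by move=> Ua Ub; split; rewrite inE//; exact: open_nbhs_nbhs.
split=> [Ux|Uy]; apply: contrapT => nU; apply: H; exists U.
  by left; exact: Hn.
by right; exact: Hn.
Qed.

Lemma cont_rel_fun (X : topologicalType) (M : baire -> X -> Prop) p x y :
  t0 X -> cont_rel M -> M p x -> M p y -> x = y.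
Proof.
move=> tX cM Mx My; apply: tX => U oU.
split=> [Ux|Uy]; [have [n] := cM U oU p x Mx Ux|have [n] := cM U oU p y My Uy];
  exact.
Qed.

Lemma rel_open_lift (X : Type) (N M : baire -> X -> Prop) (U : set X) :
  lifts N M -> rel_open N U -> rel_open M U.
Proof.
move=> [g [gN gc]] oU p x Mpx Ux; have [n nU] := oU _ _ (gN _ _ Mpx) Ux.
have [|j _|m Hm] := @uniform_bound (fun j m => forall q y, M q y ->
    agree m p q -> g p j = g q j) n.
- by move=> i m m' mm' H q y My /(agreeW mm'); exact: H My.
- exact: gc Mpx.
exists m => q y pq My; apply: (nU (g q)); last exact: gN.
by move=> i ni; exact: Hm My pq.
Qed.

Lemma cont_rel_lift (X : topologicalType) (N M : baire -> X -> Prop) :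
  cont_rel N -> lifts N M -> cont_rel M.
Proof. by move=> cN NM U oU; apply: rel_open_lift NM _; exact: cN. Qed.

Lemma quot_cont_rel (X : topologicalType) (N : baire -> X -> Prop) :
  quot_rel N -> cont_rel N.
Proof. by move=> [_ H] U /H. Qed.

Lemma cont_rel_map (X Y : topologicalType) (f : X -> Y) (M : baire -> X -> Prop) :
  continuous f -> cont_rel M -> cont_rel (rel_map f M).
Proof.
move=> /continuousP cf cM U oU p _ [x Mpx <-] Ux.
have [n nU] := cM _ (cf _ oU) p x Mpx Ux.
by exists n => q _ pq [y My <-]; exact: nU pq My.
Qed.

Lemma quot_continuous (X Y : topologicalType) (f : X -> Y)
    (M : baire -> X -> Prop) :
  quot_rel M -> cont_rel (rel_map f M) -> continuous f.
Proof.
move=> [_ qM] cM; apply/continuousP => U oU; apply/qM => p x Mpx Ux.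
have [|n nU] := cM U oU p (f x) _ Ux; first by exists x.
by exists n => q y pq My; apply: nU pq _; exists y.
Qed.

(** A name of [x] lists the basic open sets around some point [b] of the countably based space that
    is mapped to [x]. *)
Lemma quot_of_qcb0 (X : topologicalType) : qcb0_space X ->
  exists M : baire -> X -> Prop, quot_rel M.
Proof.
move=> [_ [B [f [[Bs cBs [Bso Bsb]] [fsurj fq]]]]].
have [c ci] : exists c : set B -> nat, {in Bs &, injective c}.
  by have /pcard_leP/unsquash c := cBs; exists c; exact: inj.
pose names (p : baire) (b : B) := forall U, Bs U -> (U b <-> exists n, p n = (c U).+1).
(* A finite list of basic neighbourhoods of [b] extends to a name of [b]. Position [k >= n] is
   reserved for the basic set of code [k - n], and [0] is a blank. *)
have exname n (p : baire) b :
    (forall U, Bs U -> (exists2 k, k < n & p k = (c U).+1) -> U b) ->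
    exists2 q, agree n p q & names q b.
  move=> Hp; exists (fun k => if k < n then p k else
      if `[< exists U, [/\ Bs U, c U = k - n & U b] >] then (k - n).+1 else 0).
    by move=> i ->.
  move=> U BU; split=> [Ub|[k]].
    exists (c U + n); rewrite ltnNge leq_addl /= addnK.
    by case: asboolP => // -[]; exists U.
  case: ltnP => kn; first by move=> pk; apply: Hp => //; exists k.
  case: asboolP => // -[V [BV cV Vb]] [/esym cU].
  by rewrite (ci U V)// ?inE// cU cV.
exists (fun p x => exists2 b, names p b & f b = x); split.
  move=> x; have [b fb] := fsurj x.
  have [|q _ qb] := @exname 0 (fun=> 0) b; first by move=> U _ [].
  by exists q, b.
move=> U; rewrite fq; split=> [oU p _ [b pb <-] Ub|oU].
  have [V [BV Vb] VU] := Bsb b _ (open_nbhs_nbhs (conj oU Ub)).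
  have [k pk] := (pb V BV).1 Vb; exists k.+1 => q _ pq [b' qb' <-].
  by apply: VU; apply/(qb' V BV); exists k; rewrite -pq.
rewrite openE => b Ub.
have [|p _ pb] := @exname 0 (fun=> 0) b; first by move=> V _ [].
have [|n nU] := oU p (f b) _ Ub; first by exists b.
(* The first [n] values of [p] mention finitely many basic sets; each point in all of them has a
   name with this prefix and is therefore mapped into [U]. *)
have nb : nbhs b [set b' | forall V, Bs V ->
    (exists2 k, k < n & p k = (c V).+1) -> V b'].
  elim: n {nU} => [|n IH]; first by apply: filterS filterT => b' _ V _ [].
  have : nbhs b [set b' | forall V, Bs V -> p n = (c V).+1 -> V b'].
    have [[V BV pV]|nV] := pselect (exists2 V, Bs V & p n = (c V).+1).
      have Vb : V b by apply/(pb V BV); exists n.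
      have := open_nbhs_nbhs (conj (Bso _ BV) Vb); apply: filterS => b' Vb' V' BV'.
      by rewrite pV => -[cVV]; rewrite -(ci V V') ?inE.
    by apply: filterS filterT => b' _ V BV pV; exfalso; apply: nV; exists V.
  move/(filterI IH); apply: filterS => b' [H1 H2] V BV [k].
  rewrite ltnS leq_eqVlt => /predU1P[->|kn]; first exact: H2.
  by move=> pk; apply: H1 => //; exists k.
apply: filterS nb => b' Hb'; have [q pq qb'] := exname n p b' Hb'.
by apply: (nU q) => //; exists b'.
Qed.

(** The countably based space is the set of names itself, on which [M] is single-valued because [X]
    is T0. *)
Lemma qcb0_of_quot (X : topologicalType) (M : baire -> X -> Prop) :
  t0 X -> quot_rel M -> qcb0_space X.
Proof.
move=> tX [Msurj Mq]; split; first exact/t0P.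
pose Z := [set p | exists x, M p x].
have /choice[f fM] : forall p : Z, exists x, M (set_val p) x.
  by move=> p; have /set_mem := valP p.
have cM : cont_rel M by move=> U /Mq.
exists Z, f; split.
  exists [set [set q : Z | mkseq (set_val q) (size w) = w] | w in [set: seq nat]].
    by apply: sub_countable (card_image_le _ _) _; exact: countableP.
  split=> [_ [w _ <-]|p A].
    apply/baire_sub_openP => p pw; exists (size w) => q /mkseq_agree pq.
    by rewrite /mkset -pq.
  rewrite nbhsE => -[U [/baire_sub_openP oU /oU[n nU]] UA].
  exists [set q : Z | mkseq (set_val q) n = mkseq (set_val p) n] => /=.
    by split=> //; exists (mkseq (set_val p) n); rewrite ?size_mkseq.
  by move=> q /esym/mkseq_agree/nU/UA.
split=> [x|U]; first have [p Mpx] := Msurj x.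
  have Zp : p \in Z by rewrite inE; exists x.
  exists (exist _ p Zp).
  exact: (cont_rel_fun tX cM (fM (exist _ p Zp))).
rewrite Mq baire_sub_openP; split=> [oU p Up|oU p x Mpx Ux].
  have [n nU] := oU _ _ (fM p) Up; exists n => q pq; exact: nU pq (fM q).
have Zp q y : M q y -> q \in Z by rewrite inE; exists y.
have fE q y (Mqy : M q y) : f (exist _ q (Zp _ _ Mqy)) = y.
  exact: (cont_rel_fun tX cM (fM (exist _ q (Zp _ _ Mqy)))).
have [|n nU] := oU (exist _ p (Zp _ _ Mpx)); first by rewrite /preimage/= fE.
exists n => q y pq Mqy; rewrite -(fE _ _ Mqy).
exact: (nU (exist _ q (Zp _ _ Mqy))).
Qed.

Definition hps (X : topologicalType) : Prop :=
  t0 X /\ exists N : baire -> X -> Prop, hp_naming N.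

Lemma hps_qcb0 (X : topologicalType) : hps X -> qcb0_space X.
Proof. by move=> [tX [N [qN _ _]]]; exact: qcb0_of_quot qN. Qed.

Lemma continuous_cont_rel (Z : set baire) (X : topologicalType) (f : Z -> X) :
  continuous f <-> cont_rel (fun p x => exists2 z : Z, set_val z = p & f z = x).
Proof.
split=> [/continuousP cf U /cf /baire_sub_openP oU _ _ [z <- <-] Uz|cf].
  by have [n nU] := oU z Uz; exists n => q' x' zq [y yq <-]; apply: nU; rewrite yq.
apply/continuousP => U oU; apply/baire_sub_openP => z Uz.
have [|n nU] := cf U oU (set_val z) (f z) _ Uz; first by exists z.
by exists n => q zq; apply: (nU (set_val q)) => //; exists q.
Qed.

Lemma hyperprojectiveP (X : QCB0) : hyperprojective X <-> hps (sval X).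
Proof.
case: X => X qX /=; split=> [[W [a [d [[cd dadm] SE]]]]|[tX [N [qN aN hN]]]].
  have tX : t0 X by apply/t0P; exact: qX.1.
  split=> //; exists (fun p x => exists2 z : rep_dom d, set_val z = p & d z = x).
  have cN := (continuous_cont_rel d).1 cd.
  have aN M : cont_rel M -> lifts
     (fun p x => exists2 z : rep_dom d, set_val z = p & d z = x) M.
    move=> cM; pose Z := [set p | exists x, M p x].
    have /choice[f fM] : forall p : Z, exists x, M (set_val p) x.
      by move=> p; have /set_mem := valP p.
    have [|g [cg fg]] := dadm Z f.
      apply/continuous_cont_rel => U oU p x [z <- <-] Uz.
      have [n nU] := cM U oU _ _ (fM z) Uz.
      by exists n => q' x' zq [y yq <-]; apply: nU (fM y); rewrite yq.
    pose g' (p : baire) := if pselect (p \in Z) is left h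
      then set_val (g (exist _ p h)) else p.
    have g'E (z : Z) : g' (set_val z) = set_val (g z).
      rewrite /g'; case: pselect => [h|]; last by case; exact: (valP z).
      by congr (set_val (g _)); exact: val_inj.
    have Zex p x : M p x -> exists2 z : Z, set_val z = p & f z = x.
      move=> Mpx; have Zp : p \in Z by rewrite inE; exists x.
      exists (exist _ p Zp) => //.
      exact: (cont_rel_fun tX cM (fM (exist _ p Zp))).
    exists g'; split=> [p x /Zex[z <- <-]|p x j /Zex[z <- _]].
      by rewrite g'E fg; exists (g z).
    (* Pulled back along [g], this cylinder yields a modulus for the value at [j]. *)
    have oU : open [set z' : rep_dom d | agree j.+1 (set_val (g z)) (set_val z')].
      by exists [set q | agree j.+1 (set_val (g z)) q] => //; exact: agree_open.
    have /continuousP/(_ _ oU)/baire_sub_openP/(_ z) := cg.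
    case=> [|m Hm]; first exact: agreexx.
    exists m => q y /Zex[z' <- _] zz'; rewrite !g'E.
    exact: (Hm z' zz' j).
  split=> //; last first.
    move: SE => /(ex_intro _ a)/(ex_intro _ W)/hp2_pairs; apply: hp_ext => u.
    split=> [[p [q [/= pu qu dpq]]]|[x [[p pu px] [q qu qx]]]].
      by exists (d p); split; [exists p|exists q].
    by exists p, q; rewrite px qx pu qu.
  split=> [x|U]; first by have [z dz] := rep_surj d x; exists (set_val z), z.
  split=> [|oU]; first exact: cN.
  (* The quotient naming [M] lifts to [d], so a set open for the names of [d] is open for those of
     [M], hence open in [X]. *)
  have [M [Ms Mq]] := quot_of_qcb0 qX.
  apply/Mq; apply: rel_open_lift oU; apply: aN => V; exact: (Mq V).1.
pose D := [set p | exists x, N p x].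
have cN := quot_cont_rel qN.
have /choice[f fN] : forall p : D, exists x, N (set_val p) x.
  by move=> p; have /set_mem := valP p.
have Dex p x : N p x -> exists2 z : D, set_val z = p & f z = x.
  move=> Npx; have Dp : p \in D by rewrite inE; exists x.
  by exists (exist _ p Dp) => //; exact: (cont_rel_fun tX cN (fN (exist _ p Dp))).
have fs x : exists p, f p = x.
  by have [p /Dex[z _ fz]] := qN.1 x; exists z.
pose d := Representation fs.
have [W [a SE]] : hp (EQ d).
  apply/hp2_pairs; apply: hp_ext hN => u; split.
    by move=> [x [/Dex[p pu px] /Dex[q qu qx]]]; exists p, q; rewrite /= px qx.
  move=> [p [q [/= -> -> dpq]]]; exists (f p); split; first exact: fN.
  by rewrite [f p]dpq; exact: fN.
exists W, a, d; split=> //; split.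
  apply/continuous_cont_rel => U oU p x [z <- <-] Uz.
  have [n nU] := cN U oU _ _ (fN z) Uz.
  by exists n => q' x' zq [y yq <-]; apply: nU (fN y); rewrite yq.
move=> Z nu /continuous_cont_rel/aN[g [gN gc]].
have gD (z : Z) : g (set_val z) \in D.
  by rewrite inE; exists (nu z); apply: gN; exists z.
exists (fun z => exist _ (g (set_val z)) (gD z)); split.
  apply/continuousP => U /baire_sub_openP oU; apply/baire_sub_openP => z Uz.
  have [n nU] := oU _ Uz.
  have [|j _|m Hm] := @uniform_bound (fun j m => forall q : Z,
      agree m (set_val z) (set_val q) -> g (set_val z) j = g (set_val q) j) n.
  - by move=> i m m' mm' H q /(agreeW mm'); exact: H.
  - have [|m Hm] := gc (set_val z) (nu z) j; first by exists z.
    by exists m => q; apply: Hm; exists q.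
  by exists m => q zq; apply: nU => j jn /=; exact: Hm.
apply: funext => z /=.
have /Dex[z' z'e <-] : N (g (set_val z)) (nu z) by apply: gN; exists z.
by congr f; apply: val_inj; rewrite /= -z'e.
Qed.

(** * Products, subspaces, coproducts and the Sierpinski space *)

(** The parameter [N] is a phantom that selects the topology with open sets [rel_open N]. *)
Definition named (X : Type) (N : baire -> X -> Prop) : Type := X.

Section named_topology.
Variables (X : Type) (N : baire -> X -> Prop).

Let openT : rel_open N setT.
Proof. by move=> p x _ _; exists 0. Qed.

Let openI : setI_closed (rel_open N).
Proof.
move=> U V oU oV p x Npx [Ux Vx].
have [m mU] := oU p x Npx Ux; have [n nV] := oV p x Npx Vx.
exists (maxn m n) => q y pq Nqy; split.
  by apply: mU Nqy; apply: agreeW pq; exact: leq_maxl.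
by apply: nV Nqy; apply: agreeW pq; exact: leq_maxr.
Qed.

Let open_bigU (I : Type) (U : I -> set X) :
  (forall i, rel_open N (U i)) -> rel_open N (\bigcup_i U i).
Proof.
move=> oU p x Npx [i _ Ux]; have [n nU] := oU i p x Npx Ux.
by exists n => q y pq Nqy; exists i => //; exact: nU pq Nqy.
Qed.

HB.instance Definition _ := gen_eqMixin (named N).
HB.instance Definition _ := gen_choiceMixin (named N).
HB.instance Definition _ :=
  isOpenTopological.Build (named N) openT openI open_bigU.

Lemma named_openE (U : set (named N)) : open U = rel_open N U.
Proof. by []. Qed.

Lemma named_cont_rel : @cont_rel (named N) N.
Proof. by []. Qed.

Lemma named_quot : (forall x, exists p, N p x) -> @quot_rel (named N) N.
Proof. by []. Qed.

Lemma named_continuous (Y : topologicalType) (f : named N -> Y) :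
  cont_rel (rel_map f N) -> continuous f.
Proof.
move=> cf; apply/continuousP => U oU; rewrite named_openE => p x Npx Ux.
have [|n nU] := cf U oU p (f x) _ Ux; first by exists x.
by exists n => q y pq Nqy; apply: nU pq _; exists y.
Qed.

End named_topology.

Lemma t0_separated (X : topologicalType) :
  (forall x y : X, x <> y -> exists (Y : topologicalType) (f : X -> Y),
    [/\ continuous f, t0 Y & f x <> f y]) -> t0 X.
Proof.
move=> H x y xy; apply: contrapT => /H[Y [f [/continuousP cf tY]]]; apply.
by apply: tY => U oU; exact: (xy (f @^-1` U) (cf _ oU)).
Qed.

Lemma lifts_continuous (X Y : topologicalType) (f : Y -> X) N M :
  @cont_rel X N -> @quot_rel Y M -> lifts N (rel_map f M) -> continuous f.
Proof. by move=> cN qM l; apply: quot_continuous qM _; exact: cont_rel_lift l. Qed.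

Lemma hpn_cont (X : topologicalType) (N : baire -> X -> Prop) :
  hp_naming N -> cont_rel N.
Proof. by move=> /hpn_quot/quot_cont_rel. Qed.
Arguments hpn_cont {X N} _ U _ p x.

Lemma lifts_cts (X : Type) (N M : baire -> X -> Prop) g : cts g ->
  (forall p x, M p x -> N (g p) x) -> lifts N M.
Proof.
move=> cg gN; exists g; split=> // p x j _; have [m Hm] := cg p j.
by exists m => q y _; exact: Hm.
Qed.

Lemma cont_rel_comp (X : topologicalType) (N M : baire -> X -> Prop) g :
  cts g -> (forall p x, M p x -> N (g p) x) -> cont_rel N -> cont_rel M.
Proof. by move=> cg gN /cont_rel_lift; apply; exact: lifts_cts gN. Qed.

Section product.
Variables (I : Type) (c : I -> nat) (X : I -> topologicalType).
Variable N : forall i, baire -> X i -> Prop.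
Hypotheses (c_inj : injective c) (hN : forall i, hp_naming (@N i)).
Hypothesis tX : forall i, t0 (X i).

Definition prod_name (p : baire) (x : forall i, X i) : Prop :=
  forall i, N (prn p (c i)) (x i).

Definition prod_space : topologicalType := named prod_name.

Lemma prod_lifts (M : baire -> prod_space -> Prop) :
  (forall i, cont_rel (rel_map (fun x => x i) M)) -> lifts prod_name M.
Proof.
move=> cM; have /choice[g Hg] : forall k, exists g : baire -> baire,
    forall i, c i = k -> (forall p x, M p x -> N (g p) (x i)) /\
      forall p x j, M p x ->
      exists m, forall q y, M q y -> agree m p q -> g p j = g q j.
  move=> k; have [[i <-]|H] := pselect (exists i, c i = k); last first.
    by exists id => i ck; exfalso; apply: H; exists i.
  have [g [gN gc]] := hpn_adm (hN i) (cM i).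
  exists g => _ /c_inj ->; split=> [p x Mpx|p x j Mpx].
    by apply: gN; exists x.
  have [|m Hm] := gc p (x i) j; first by exists x.
  by exists m => q y Mqy; apply: Hm; exists y.
(* Codes outside the range of [c] are filled with [p], which keeps the tuple continuous. *)
exists (fun p => tup (fun k => if `[< exists i, c i = k >] then g k p else p)).
split=> [p x Mpx i|p x j Mpx].
  rewrite tupK; case: asboolP => [_|[]]; last by exists i.
  by have [H _] := Hg (c i) i erefl; exact: H.
rewrite /tup; case: unpickle => [[k n]|]; last by exists 0.
case: asboolP => [[i ck]|_]; last by exists n.+1 => q y _; apply.
by have [_ H] := Hg k i ck; exact: H Mpx.
Qed.

Lemma prod_proj_cont i : cont_rel (rel_map (fun x : prod_space => x i) prod_name).
Proof.
apply: cont_rel_comp (cts_prn (c i)) _ (hpn_cont (hN i)).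
by move=> p _ [x Hx <-].
Qed.

Lemma prod_proj_continuous i : continuous (fun x : prod_space => x i).
Proof. by apply: named_continuous; exact: prod_proj_cont. Qed.

Lemma prod_hps : hps prod_space.
Proof.
split.
  apply: t0_separated => x y xy.
  have [i xyi] : exists i, x i <> y i.
    apply: contrapT => H; apply: xy; apply: functional_extensionality_dep => i.
    by apply: contrapT => xyi; apply: H; exists i.
  by exists (X i), (fun x => x i); split=> //; exact: prod_proj_continuous.
exists prod_name; split.
- apply: named_quot => x.
  have /choice[p Hp] : forall k, exists p, forall i, c i = k -> N p (x i).
    move=> k; have [[i <-]|H] := pselect (exists i, c i = k); last first.
      by exists (fun=> 0) => i ck; exfalso; apply: H; exists i.
    have [p Hp] := (hpn_quot (hN i)).1 (x i).
    by exists p => j /c_inj ->.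
  by exists (tup p) => i; rewrite tupK; exact: Hp.
- move=> M cM; apply: prod_lifts => i.
  exact: cont_rel_map (@prod_proj_continuous i) cM.
have : hp [set u | forall i, same_name (@N i) (prn (prl u) (c i)) (prn (prr u) (c i))].
  apply: (hp_all c_inj) => i; apply: hp2_comp (hpn_hp (hN i)).
    exact: (cts_comp (cts_prn (c i)) (cts_prl cts_id)).
  exact: (cts_comp (cts_prn (c i)) (cts_prr cts_id)).
apply: hp_ext => u /=; split=> [H|[x [xl xr]] i].
  by exists (fun i => sval (cid (H i))); split=> i; case: (svalP (cid (H i))).
by exists (x i).
Qed.

Lemma prod_continuous (Y : topologicalType) (M : baire -> Y -> Prop)
    (f : Y -> prod_space) : quot_rel M ->
  (forall i, continuous (fun y => f y i)) -> continuous f.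
Proof.
move=> qM cf; apply: (lifts_continuous _ qM); first exact: named_cont_rel.
apply: prod_lifts => i U oU p _ [_ [y My <-] <-] Uy.
have oU' : rel_open (rel_map (f^~ i) M) U.
  exact: cont_rel_map (cf i) (quot_cont_rel qM) _ oU.
have [|n nU] := oU' p (f y i) _ Uy; first by exists y.
by exists n => q _ pq [_ [z Mz <-] <-]; apply: nU pq _; exists z.
Qed.

End product.

Section subspace.
Variables (X : topologicalType) (N : baire -> X -> Prop) (A : set X).
Hypotheses (hN : hp_naming N) (tX : t0 X).
Hypothesis hA : hp [set p | exists x, N p x /\ A x].

Definition sub_name (p : baire) (x : {x | A x}) : Prop := N p (sval x).

(** This topology may be strictly finer than the subspace topology, which need not be a quotient of
    the inherited names. *)
Definition sub_space : topologicalType := named sub_name.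

Definition sub_in : sub_space -> X := sval.

Lemma sub_lifts (M : baire -> sub_space -> Prop) :
  cont_rel (rel_map sub_in M) -> lifts sub_name M.
Proof.
move=> /(hpn_adm hN)[g [gN gc]]; exists g; split=> [p x Mpx|p x j Mpx].
  by apply: gN; exists x.
have [|m Hm] := gc p (sval x) j; first by exists x.
by exists m => q y Mqy; apply: Hm; exists y.
Qed.

Lemma sub_in_continuous : continuous sub_in.
Proof.
apply: named_continuous; apply: cont_rel_comp cts_id _ (hpn_cont hN).
by move=> p _ [x Nx <-].
Qed.

Lemma sub_in_inj : injective sub_in.
Proof. by move=> [x Ax] [y Ay] /= xy; exact: eq_exist. Qed.

Lemma sub_hps : hps sub_space.
Proof.
split.
  apply: t0_separated => x y xy; exists X, sub_in; split=> //.
    exact: sub_in_continuous.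
  by move=> /sub_in_inj.
exists sub_name; split.
- by apply: named_quot => x; exact: (hpn_quot hN).1.
- move=> M cM; apply: sub_lifts; exact: cont_rel_map sub_in_continuous cM.
have := hp_and (hpn_hp hN) (hp_comp (cts_prl cts_id) hA).
apply: hp_ext => u /=; split=> [[[x [xl xr]] [y [yl Ay]]]|[x [xl xr]]].
  have yx : y = x := cont_rel_fun tX (hpn_cont hN) yl xl.
  by subst y; exists (exist _ x Ay).
split; first by exists (sval x).
by exists (sval x); split=> //; exact: (svalP x).
Qed.

Lemma sub_continuous (Y : topologicalType) (M : baire -> Y -> Prop)
    (f : Y -> sub_space) : quot_rel M ->
  continuous (sub_in \o f) -> continuous f.
Proof.
move=> qM cf; apply: (lifts_continuous _ qM); first exact: named_cont_rel.
apply: sub_lifts => U oU p _ [_ [y My <-] <-] Uy.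
have oU' : rel_open (rel_map (sub_in \o f) M) U.
  exact: cont_rel_map cf (quot_cont_rel qM) _ oU.
have [|n nU] := oU' p (sub_in (f y)) _ Uy; first by exists y.
by exists n => q _ pq [_ [z Mz <-] <-]; apply: nU pq _; exists z.
Qed.

End subspace.

Section coproduct.
Variables (I : Type) (c : I -> nat) (X : I -> topologicalType).
Variable N : forall i, baire -> X i -> Prop.
Hypotheses (c_inj : injective c) (hN : forall i, hp_naming (@N i)).
Hypothesis tX : forall i, t0 (X i).

Definition coprod_name (p : baire) (s : {i & X i}) : Prop :=
  p 0 = c (projT1 s) /\ N (btail p) (projT2 s).

Definition coprod_space : topologicalType := named coprod_name.

Definition coprod_in i (x : X i) : coprod_space := existT X i x.

Lemma coprod_openP (U : set coprod_space) :
  open U <-> forall i, open (@coprod_in i @^-1` U).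
Proof.
rewrite named_openE; split=> [oU i|oU p [i x] [/= p0 Nx] Ux].
  apply/(hpn_quot (hN i)).2 => p x Nx Ux.
  have [|n nU] := oU (bcons (c i) p) (coprod_in x) _ Ux; first by split.
  exists n => q y pq Ny; apply: (nU (bcons (c i) q)); last by split.
  by move=> [|j]// jn; apply: pq; exact: ltnW.
have [n nU] := hpn_cont (hN i) _ (oU i) (btail p) x Nx Ux.
exists n.+1 => q [j y] pq [/= q0 Ny].
have ji : j = i by apply: c_inj; rewrite -p0 -q0 pq.
by subst j; apply: (nU (btail q)) => // k kn; exact: pq.
Qed.

Lemma coprod_in_continuous i : continuous (@coprod_in i).
Proof. by apply/continuousP => U /coprod_openP. Qed.

(** The set is [V] on summand [i] and everything on the others; the quantifier over [e] expresses
    this without a case analysis on indices. *)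
Lemma coprod_fiber_open i (V : set (X i)) : open V ->
  open [set s : coprod_space |
    forall e : projT1 s = i, V (eq_rect _ X (projT2 s) _ e)].
Proof.
move=> oV; apply/coprod_openP => j; have [ji|nji] := pselect (j = i).
  subst j; rewrite (_ : _ @^-1` _ = V)//; apply/seteqP; split=> x /=.
    exact: (fun H => H erefl).
  by move=> Vx e; rewrite (Prop_irrelevance e erefl).
rewrite (_ : _ @^-1` _ = setT); first exact: openT.
by apply/seteqP; split=> // x _ /= e.
Qed.

Lemma coprod_index_open i : open [set s : coprod_space | projT1 s = i].
Proof.
apply/coprod_openP => j; have [ji|nji] := pselect (j = i).
  by rewrite (_ : _ @^-1` _ = setT); [exact: openT | apply/seteqP; split].
by rewrite (_ : _ @^-1` _ = set0); [exact: open0 | apply/seteqP; split].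
Qed.

Lemma coprod_t0 : t0 coprod_space.
Proof.
move=> [i x] [j y] xy; have := (xy _ (@coprod_index_open i)).1 erefl.
move=> /= ji; subst j; congr existT; apply: tX => U oU.
have Ue z : U z <-> forall e : i = i, U (eq_rect _ X z _ e).
  by split=> [Uz e|/(_ erefl)//]; rewrite (Prop_irrelevance e erefl).
by rewrite !Ue; exact: xy (@coprod_fiber_open i U oU).
Qed.

(** Each summand is open, so a finite prefix of a name fixes the summand, and from there on the lift
    into that summand applies. *)
Lemma coprod_adm (M : baire -> coprod_space -> Prop) :
  cont_rel M -> lifts coprod_name M.
Proof.
move=> cM; pose Mi i p x := M p (@coprod_in i x).
have cMi i : cont_rel (Mi i).
  move=> U oU p x Mpx Ux.
  have [|n nU] := cM _ (openI (@coprod_index_open i) (@coprod_fiber_open i U oU)) p _ Mpx.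
    by split=> //= e; rewrite (Prop_irrelevance e erefl).
  by exists n => q y pq Mqy; have [_ /(_ erefl)] := nU q _ pq Mqy.
have gP i : {g : baire -> baire | (forall p x, Mi i p x -> N (g p) x) /\
    forall p x j, Mi i p x ->
      exists m, forall q y, Mi i q y -> agree m p q -> g p j = g q j}.
  by apply: cid; exact: (hpn_adm (hN i) (cMi i)).
pose g i := sval (gP i).
have /choice[h hP] : forall p, exists q : baire, forall s, M p s ->
    q = bcons (c (projT1 s)) (g (projT1 s) p).
  move=> p.
  have [[s Ms]|H] := pselect (exists s, M p s); last first.
    by exists p => s Ms; exfalso; apply: H; exists s.
  exists (bcons (c (projT1 s)) (g (projT1 s) p)) => t Mt.
  by rewrite (cont_rel_fun coprod_t0 cM Ms Mt).
exists h; split=> [p [i x] Mpx|p [i x] j Mpx].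
  by rewrite (hP _ _ Mpx); split=> //=; have [H _] := svalP (gP i); exact: H.
have [n ni] := cM _ (@coprod_index_open i) p _ Mpx erefl.
have [m Hm] : exists m, forall q y, Mi i q y -> agree m p q ->
    bcons (c i) (g i p) j = bcons (c i) (g i q) j.
  case: j => [|j]; first by exists 0.
  by have [_ H] := svalP (gP i); exact: (H p x j).
exists (maxn m n) => q [k y] Mqy pq.
have ki : k = i by apply: (ni q) Mqy; apply: agreeW pq; exact: leq_maxr.
subst k; rewrite (hP _ _ Mpx) (hP _ _ Mqy) /=; apply: Hm Mqy _.
by apply: agreeW pq; exact: leq_maxl.
Qed.

Lemma coprod_hps : hps coprod_space.
Proof.
split; first exact: coprod_t0.
exists coprod_name; split.
- apply: named_quot => -[i x]; have [p Np] := (hpn_quot (hN i)).1 x.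
  by exists (bcons (c i) p).
- exact: coprod_adm.
have : hp [set u | exists i, (prl u 0 = c i /\ prr u 0 = c i) /\
    same_name (@N i) (btail (prl u)) (btail (prr u))].
  apply: (hp_exists c_inj) => i; apply: hp_and.
    apply: hp_local => p [p0 p1]; exists 2 => q pq.
    by rewrite /prl /prr /= -!pq.
  apply: hp2_comp (hpn_hp (hN i)).
    exact: (cts_comp cts_btail (cts_prl cts_id)).
  exact: (cts_comp cts_btail (cts_prr cts_id)).
apply: hp_ext => u; split=> [[i [[ul ur] [x [xl xr]]]]|[[i x] [[/= ul xl] [/= ur xr]]]].
  by exists (existT _ i x).
by exists i; split=> //; exists x.
Qed.

Lemma coprod_continuous (Y : topologicalType) (f : coprod_space -> Y) :
  (forall i, continuous (f \o @coprod_in i)) -> continuous f.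
Proof.
move=> cf; apply/continuousP => U oU; apply/coprod_openP => i.
by have /continuousP/(_ U oU) := cf i.
Qed.

End coproduct.

(** Points of the Sierpinski space are propositions, so that a subset of [X] is literally a map into
    it. *)
Definition sierp_name (p : baire) (b : Prop) : Prop :=
  b <-> exists n, p n != 0.

Definition sierp : topologicalType := named sierp_name.

Lemma sierp_true_open : open [set b : sierp | b].
Proof.
rewrite named_openE => p b bp /= /bp[n pn]; exists n.+1 => q d pq dq.
by apply/dq; exists n; rewrite -pq.
Qed.

(** The [n]-th value of the lift tells whether the prefix of length [n] already forces truth. *)
Lemma sierp_lifts (M : baire -> sierp -> Prop) :
  rel_open M [set b | b] -> lifts sierp_name M.
Proof.
move=> oM; pose P n p := forall q y, agree n p q -> M q y -> y.
exists (fun p n => `[< P n p >] : nat); split=> [p b Mpb|p b j Mpb].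
  split=> [/(oM p b Mpb)[n nb]|[n]].
    by exists n; case: asboolP.
  by case: asboolP => // /(_ p b (@agreexx n p) Mpb).
exists j => q y _ pq; congr (nat_of_bool `[< _ >]); apply/propext.
split=> H r z.
  by move=> qr; apply: H; exact: agree_trans qr.
by move=> pr; apply: H; apply: agree_trans pr; exact: agree_sym.
Qed.

Lemma sierp_t0 : t0 sierp.
Proof. by move=> x y xy; apply/propext; exact: xy sierp_true_open. Qed.

Lemma sierp_hp_naming : @hp_naming sierp sierp_name.
Proof.
split.
- apply: named_quot => b; exists (fun=> `[< b >] : nat); split.
    by move=> Hb; exists 0; case: asboolP.
  by move=> [_]; case: asboolP.
- by move=> M cM; apply: sierp_lifts; exact: cM sierp_true_open.
have nz f : cts f -> hp [set u | exists n, f u n != 0].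
  move=> cf; apply: hp_ex_nat => n; apply: hp_local => u /= un.
  by have [m Hm] := cf u n; exists m => v /Hm <-.
have zl := nz _ (cts_prl cts_id); have zr := nz _ (cts_prr cts_id).
apply: hp_ext (hp_and (hp_imp zl zr) (hp_imp zr zl)) => u /=.
split=> [[lr rl]|[b [bl br]]].
  by exists (exists n, prl u n != 0); split; split.
by split=> [/bl/br|/br/bl].
Qed.

Lemma sierp_hps : hps sierp.
Proof. by split; [exact: sierp_t0 | exists sierp_name; exact: sierp_hp_naming]. Qed.

Lemma sierp_continuous (X : topologicalType) (U : set X) :
  open U -> continuous (U : X -> sierp).
Proof.
move=> oU; apply/continuousP => V oV.
(* The zero sequence names [False], and each of its prefixes extends to a name of [True]. *)
have VT : V False -> V True.
  move=> VF; have [|n nV] := oV (fun=> 0) False _ VF; first by split=> [|[]].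
  by apply: (nV (fun i => ~~ (i < n) : nat)) => [i ->//|]; split=> // _;
    exists n; rewrite ltnn.
have [VF|nVF] := pselect (V False).
  rewrite (_ : _ @^-1` _ = setT); first exact: openT.
  apply/seteqP; split=> // x _ /=.
  by have [/propT ->|/propF ->] := pselect (U x); [exact: VT|].
have [V1|V1] := pselect (V True).
  rewrite (_ : _ @^-1` _ = U)//; apply/seteqP; split=> x /=.
    by have [//|/propF ->] := pselect (U x).
  by move=> /propT ->.
rewrite (_ : _ @^-1` _ = set0); first exact: open0.
apply/seteqP; split=> // x /=.
by have [/propT ->|/propF ->] := pselect (U x).
Qed.

(** * Function spaces *)

Definition mkct (X Y : topologicalType) (f : X -> Y) (cf : continuous f) :
  continuousType X Y := HB.pack f (isContinuous.Build X Y f cf).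

Lemma ct_continuous (X Y : topologicalType) (f : continuousType X Y) :
  continuous f.
Proof. exact: cts_fun. Qed.

Lemma cts_const p : cts (fun=> p).
Proof. by move=> q j; exists 0. Qed.

Ltac cts_proj := repeat first [exact: cts_id | exact: (cts_prl cts_id)
  | exact: (cts_prr cts_id) | apply: cts_prl | apply: cts_prr].

Section exponential.
Variables (X Y : topologicalType).
Variables (NX : baire -> X -> Prop) (NY : baire -> Y -> Prop).
Hypotheses (hNX : hp_naming NX) (hNY : hp_naming NY) (tX : t0 X) (tY : t0 Y).
Implicit Types f h : continuousType X Y.

Definition exp_name (r : baire) (f : continuousType X Y) : Prop :=
  forall p x, NX p x -> exists q, app r p q /\ NY q (f x).

Definition exp_space : topologicalType := named exp_name.

(** Evaluation seen as a naming of [Y]: a pair of names, of [f] and of [x], names [f x]. *)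
Definition unc (M : baire -> continuousType X Y -> Prop) (u : baire) (y : Y) :
  Prop := exists f x, [/\ M (prl u) f, NX (prr u) x & f x = y].

Lemma unc_exp_cont : cont_rel (unc exp_name).
Proof.
move=> U oU u _ [f [x [rf px <-]]] Ux; have [q [rpq qy]] := rf _ _ px.
have [k kU] := hpn_cont hNY U oU q (f x) qy Ux.
have [m Hm] := app_cont rpq k.
exists m.*2 => v _ uv [f' [x' [rf' px' <-]]]; have [q' [rpq' qy']] := rf' _ _ px'.
apply: kU qy'; apply: Hm rpq'; [exact: agree_prl | exact: agree_prr].
Qed.

(** Admissibility of [Y] lifts the uncurried naming, and [curry_app] turns that lift into
    associates. *)
Lemma exp_lifts (M : baire -> exp_space -> Prop) :
  cont_rel (unc M) -> lifts exp_name M.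
Proof.
move=> /(hpn_adm hNY)[G [GN Gc]].
have [|k ck kG] := @curry_app (fun z p => exists y, unc M (pr2 z p) y)
    (fun z p => G (pr2 z p)).
  move=> z p [y zpy] n; have [m Hm] := Gc _ _ n zpy.
  by exists m => z' p' [y' zpy'] zz pp; apply: Hm zpy' _; exact: agree_pr2.
apply: (lifts_cts ck) => z f Mzf p x px.
have zpx : unc M (pr2 z p) (f x) by exists f, x; rewrite pr2l pr2r.
by exists (G (pr2 z p)); split; [apply: kG; exists (f x) | exact: GN].
Qed.

(* The evaluation is only known to be continuous for the names of functions;
   a sequence witnessing a failure for [M] converges, hence generates a compact
   set, and the functions mapping a compact set into [U] form an open set. *)
Lemma exp_unc (M : baire -> exp_space -> Prop) :
  cont_rel M -> cont_rel (unc M).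
Proof.
move=> cM U oU u _ [f0 [x0 [uf0 ux0 <-]]] Uf0; apply: contrapT => H.
have /choice[t Ht] : forall n, exists t : baire * continuousType X Y * X,
    [/\ agree n u t.1.1, M (prl t.1.1) t.1.2, NX (prr t.1.1) t.2
      & ~ U (t.1.2 t.2)].
  move=> n; apply: contrapT => Hn; apply: H; exists n => v _ uv [f [x [vf vx <-]]].
  by apply: contrapT => Ufx; apply: Hn; exists (v, f, x).
pose W n0 := [set h : exp_space | U (h x0) /\ forall n, n0 <= n -> U (h (t n).2)].
(* The modulus [m] at the limit [x0] serves all [n >= m.*2], whose names agree with that of [x0] far
   enough; the finitely many other indices contribute their own moduli. *)
have oW n0 : open (W n0).
  rewrite named_openE => r h rh [Uh0 Uhn].
  have [|m Hm] := unc_exp_cont oU (p := pr2 r (prr u)) (x := h x0) _ Uh0.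
    by exists h, x0; rewrite pr2l pr2r.
  have [|n nm|k Hk] := @uniform_bound (fun n k => n0 <= n -> forall r' h',
      agree k r r' -> exp_name r' h' -> U (h' (t n).2)) m.*2.
  - move=> i k k' kk' Hi n0i r' h' /(agreeW kk'); exact: Hi.
  - have [n0n|nn0] := leqP n0 n; last by exists 0.
    have [_ _ xn _] := Ht n.
    have [|k Hk] := unc_exp_cont oU (p := pr2 r (prr (t n).1.1))
        (x := h (t n).2) _ (Uhn _ n0n).
      by exists h, (t n).2; rewrite pr2l pr2r.
    exists k => _ r' h' rr' rh'; apply: (Hk (pr2 r' (prr (t n).1.1))).
      exact: agree_pr2.
    by exists h', (t n).2; rewrite pr2l pr2r.
  exists (maxn m k) => r' h' rr' rh'.
  have rm : agree m r r' by apply: agreeW rr'; exact: leq_maxl.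
  split=> [|n n0n].
    apply: (Hm (pr2 r' (prr u))); first exact: agree_pr2.
    by exists h', x0; rewrite pr2l pr2r.
  have [mn|nm] := leqP m.*2 n; last first.
    by apply: (Hk n nm n0n r') => //; apply: agreeW rr'; exact: leq_maxr.
  have [un _ xn _] := Ht n.
  apply: (Hm (pr2 r' (prr (t n).1.1))).
    by apply: agree_pr2 => //; apply: agree_prr; exact: agreeW un.
  by exists h', (t n).2; rewrite pr2l pr2r.
have /continuousP/(_ _ oU) oV := @ct_continuous _ _ f0.
have [k Hk] := hpn_cont hNX _ oV (prr u) x0 ux0 Uf0.
have Wf0 : W k.*2 f0.
  split=> // n kn; have [un _ xn _] := Ht n.
  by apply: (Hk (prr (t n).1.1)) => //; apply: agree_prr; exact: agreeW un.
(* For large [n] the [n]-th function lies in [W k.*2], hence maps the [n]-th point into [U], against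
   its choice. *)
have [m Hm] := cM _ (oW k.*2) _ _ uf0 Wf0.
have [un fn _] := Ht (maxn m.*2 k.*2); apply.
have [|_] := Hm _ _ _ fn.
  by apply: agree_prl; apply: agreeW un; exact: leq_maxl.
by apply; exact: leq_maxr.
Qed.

Lemma exp_eval_continuous x : continuous (fun f : exp_space => f x).
Proof.
apply: named_continuous; have [p px] := (hpn_quot hNX).1 x.
apply: (cont_rel_comp (cts_pr2 cts_id (cts_const p)) _ unc_exp_cont).
by move=> r _ [f rf <-]; exists f, x; rewrite pr2l pr2r.
Qed.

(** In the constant naming every sequence names [f], so any value of its lift is an associate of
    [f]. *)
Lemma exp_name_ex f : exists r, exp_name r f.
Proof.
have [|g [gN _]] := @exp_lifts (fun=> eq f).
  move=> U oU u _ [_ [x [<- ux <-]]] Ux.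
  have /continuousP/(_ _ oU) oV := @ct_continuous _ _ f.
  have [n nV] := hpn_cont hNX _ oV (prr u) x ux Ux.
  exists n.*2 => v _ uv [_ [x' [<- vx <-]]].
  by apply: nV vx; exact: agree_prr.
by exists (g (fun=> 0)); exact: gN.
Qed.

Lemma exp_t0 : t0 exp_space.
Proof.
apply: t0_separated => f h fh.
have [x fhx] : exists x, f x <> h x.
  apply: contrapT => H; apply: fh; apply/continuousEP => x.
  by apply: contrapT => fhx; apply: H; exists x.
exists Y, (fun f : exp_space => f x); split=> //; exact: exp_eval_continuous.
Qed.

(** The right-hand side quantifies over names only, which makes equality of functions
    hyperprojective. *)
Lemma exp_same_name r r' : same_name exp_name r r' <->
  forall p p', same_name NX p p' ->
    exists q q', [/\ app r p q, app r' p' q' & same_name NY q q'].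
Proof.
split=> [[f [rf r'f]] p p' [x [px p'x]]|H].
  have [q [rpq qf]] := rf p x px; have [q' [rpq' qf']] := r'f p' x p'x.
  by exists q, q'; split=> //; exists (f x).
have fP x : exists y, forall p p', NX p x -> NX p' x ->
    exists q q', [/\ app r p q, app r' p' q', NY q y & NY q' y].
  have [p0 p0x] := (hpn_quot hNX).1 x.
  have cN := hpn_cont hNY.
  have [|q0 [q0' [r0 r0' [y [qy qy']]]]] := H p0 p0; first by exists x.
  (* The value at [x] is fixed by one name [p0]; the results of [r] at [p] and of [r'] at [p'] are
     compared with it by applying [H] to [p, p0] and to [p0, p']. *)
  exists y => p p' px p'x.
  have [|q [q1' [rq rq1' [y1 [qy1 qy1']]]]] := H p p0; first by exists x.
  have e1 := app_fun rq1' r0'; subst q1'.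
  have ey := cont_rel_fun tY cN qy1' qy'; subst y1.
  have [|q1 [q' [rq1 rq' [y2 [qy2 qy2']]]]] := H p0 p'; first by exists x.
  have e2 := app_fun rq1 r0; subst q1.
  have ey := cont_rel_fun tY cN qy2 qy; subst y2.
  by exists q, q'.
have /choice[f Hf] := fP.
have cf : continuous f.
  apply: (quot_continuous (hpn_quot hNX)) => U oU p _ [x px <-] Ux.
  have [q [_ [rpq _ qy _]]] := Hf x p p px px.
  have [k kU] := hpn_cont hNY U oU q (f x) qy Ux.
  have [m Hm] := app_cont rpq k.
  exists m => p1 _ pp1 [x1 p1x1 <-].
  have [q1 [_ [rpq1 _ qy1 _]]] := Hf x1 p1 p1 p1x1 p1x1.
  by apply: kU qy1; exact: Hm rpq1.
by exists (mkct cf); split=> p x px; have [q [q' []]] := Hf x p p px px;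
  [exists q | exists q'].
Qed.

Lemma exp_hp_naming : @hp_naming exp_space exp_name.
Proof.
split.
- exact/named_quot/exp_name_ex.
- by move=> M /exp_unc/exp_lifts.
apply: (@hp_ext _ [set u | forall p p', same_name NX p p' -> exists q q',
    [/\ app (prl u) p q, app (prr u) p' q' & same_name NY q q']]).
  by move=> u /=; rewrite exp_same_name.
apply: hp_allb; apply: hp_allb; apply: hp_imp.
  by apply: hp2_comp (hpn_hp hNX); cts_proj.
apply: hp_exb; apply: hp_exb.
apply: (@hp_ext _ [set v | (app (prl (prl (prl (prl (prl v)))))
   (prr (prl (prl (prl v)))) (prr (prl v)) /\
   app (prr (prl (prl (prl (prl v))))) (prr (prl (prl v))) (prr v)) /\
   same_name NY (prr (prl v)) (prr v)]).
  by move=> v /=; split=> [[[]]|[]].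
apply: hp_and; first apply: hp_and.
- by apply: hp_app; cts_proj.
- by apply: hp_app; cts_proj.
by apply: hp2_comp (hpn_hp hNY); cts_proj.
Qed.

Lemma exp_continuous (Z : topologicalType) (M : baire -> Z -> Prop)
    (h : Z -> exp_space) : quot_rel M ->
  cont_rel (unc (rel_map h M)) -> continuous h.
Proof.
move=> qM ch; apply: (@lifts_continuous exp_space Z h exp_name M) => //.
exact: exp_lifts.
Qed.

Definition name_graph (f : X -> Y) (p q : baire) : Prop :=
  exists x, NX p x /\ NY q (f x).

(** An associate of [f], as a fixed parameter, computes one name of [f x]; the others are those
    equal to it in [Y]. *)
Lemma name_graph_hp (f : X -> Y) : continuous f -> hp2 (name_graph f).
Proof.
move=> cf; have [r rf] := exp_name_ex (mkct cf).
apply: (@hp_ext _ [set u | same_name NX (prl u) (prl u) /\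
   exists t, app r (prl u) t /\ same_name NY t (prr u)]).
  move=> u; split=> [[[x [ux _]] [t [rt [y [ty uy]]]]]|[x [ux uy]]].
    exists x; split=> //; have [q [rq qy]] := rf _ _ ux.
    have e := app_fun rt rq; subst t.
    have e : y = f x := cont_rel_fun tY (hpn_cont hNY) ty qy.
    by rewrite -e.
  split; first by exists x.
  by have [q [rq qy]] := rf _ _ ux; exists q; split=> //; exists (f x).
apply: hp_and.
  by apply: hp2_comp (hpn_hp hNX); exact: (cts_prl cts_id).
apply: hp_exb; apply: hp_and.
  by apply: hp_app; [exact: cts_const | | ]; cts_proj.
by apply: hp2_comp (hpn_hp hNY); cts_proj.
Qed.

Lemma eq_set_hp (f g : X -> Y) : continuous f -> continuous g ->
  hp [set p | exists x, NX p x /\ f x = g x].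
Proof.
move=> /name_graph_hp hf /name_graph_hp hg.
have := @hp_exb (fun p q => name_graph f p q /\ name_graph g p q) (hp_and hf hg).
apply: hp_ext => p.
split=> [[q [[x [px qx]] [y [py qy]]]]|[x [px fg]]].
  have e := cont_rel_fun tX (hpn_cont hNX) py px; subst y.
  by exists x; split=> //; exact: cont_rel_fun tY (hpn_cont hNY) qx qy.
have [q qx] := (hpn_quot hNY).1 (f x).
by exists q; split; exists x; rewrite -?fg.
Qed.

End exponential.

(** * Universal constructions on topological spaces *)

Lemma hps_product (I : Type) (c : I -> nat) (X : I -> topologicalType) :
  injective c -> (forall i, hps (X i)) ->
  exists (P : topologicalType) (pr : forall i, continuousType P (X i)),
  [/\ hps P, (forall x y : P, (forall i, pr i x = pr i y) -> x = y)
    & forall (Q : topologicalType) (f : forall i, continuousType Q (X i)),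
      qcb0_space Q -> exists u : continuousType Q P,
        forall i t, pr i (u t) = f i t].
Proof.
move=> ci hX; pose N i := sval (cid (hX i).2).
have hN i : hp_naming (N i) := svalP (cid (hX i).2).
exists (prod_space c N), (fun i => mkct (@prod_proj_continuous _ c _ _ hN i)).
split; first by apply: prod_hps => // i; exact: (hX i).1.
  by move=> x y xy; apply: functional_extensionality_dep => i; exact: xy.
move=> Q f /quot_of_qcb0[M qM].
have cu : continuous ((fun t i => f i t) : Q -> prod_space c N).
  by apply: (prod_continuous ci hN qM) => i; exact: ct_continuous.
by exists (mkct cu).
Qed.

(** A whole family of pairs is equalized at once, so that a limit takes one product and one
    equalizer. *)
Lemma hps_equalizer (K : Type) (c : K -> nat) (X : topologicalType)
    (Z : K -> topologicalType) (f g : forall k, continuousType X (Z k)) :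
  injective c -> hps X -> (forall k, hps (Z k)) ->
  exists (E : topologicalType) (m : continuousType E X),
  [/\ hps E, injective m,
      (forall x, (forall k, f k x = g k x) <-> exists e, m e = x)
    & forall (Q : topologicalType) (h : continuousType Q X), qcb0_space Q ->
      (forall k t, f k (h t) = g k (h t)) ->
      exists u : continuousType Q E, forall t, m (u t) = h t].
Proof.
move=> ci [tX [N hN]] hZ; pose A := [set x | forall k, f k x = g k x].
have hA : hp [set p | exists x, N p x /\ A x].
  have hk k : hp [set p | exists x, N p x /\ f k x = g k x].
    have [tZ [NZ hNZ]] := hZ k.
    by apply: (eq_set_hp hN hNZ tX tZ); exact: ct_continuous.
  (* The first conjunct says that [p] names a point, which the second does not when [K] is empty. *)
  have := hp_and (hp_comp (cts_pr2 cts_id cts_id) (hpn_hp hN)) (hp_all ci hk).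
  apply: hp_ext => p /=; rewrite pr2l pr2r.
  split=> [[[x [px _]] H]|[x [px Ax]]].
    exists x; split=> // k; have [y [py fg]] := H k.
    by have e := cont_rel_fun tX (hpn_cont hN) py px; subst y.
  by split=> [|k]; exists x; split=> //; exact: Ax.
exists (sub_space N A), (mkct (@sub_in_continuous _ N A hN)); split.
- exact: (sub_hps hN tX hA).
- exact: (@sub_in_inj X N A).
- move=> x; split=> [Ax|[[y Ay] <-]]; last exact: Ay.
  by exists (exist _ x Ax).
move=> Q h /quot_of_qcb0[M qM] hfg.
pose u : Q -> sub_space N A := fun t => exist A (h t) (fun k => hfg k t).
have cu : continuous u.
  by apply: (sub_continuous hN qM); exact: (@ct_continuous _ _ h).
by exists (mkct cu).
Qed.

Lemma hps_coproduct (I : Type) (c : I -> nat) (X : I -> topologicalType) :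
  injective c -> (forall i, hps (X i)) ->
  exists (P : topologicalType) (inj : forall i, continuousType (X i) P),
  [/\ hps P, (forall s, exists i x, s = inj i x)
    & forall (Q : topologicalType) (f : forall i, continuousType (X i) Q),
      exists u : continuousType P Q, forall i x, u (inj i x) = f i x].
Proof.
move=> ci hX; pose N i := sval (cid (hX i).2).
have hN i : hp_naming (N i) := svalP (cid (hX i).2).
exists (coprod_space c N), (fun i => mkct (@coprod_in_continuous _ c _ _ ci hN i)).
split; first by apply: coprod_hps => // i; exact: (hX i).1.
  by move=> [i x]; exists i, x.
move=> Q f.
have cu : continuous ((fun s => f (projT1 s) (projT2 s)) : coprod_space c N -> Q).
  by apply: (coprod_continuous ci hN) => i; exact: (@ct_continuous _ _ (f i)).
by exists (mkct cu).
Qed.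

Lemma sub_baire_space (D : set baire) : exists (T : topologicalType) (v : T -> baire),
  [/\ qcb0_space T, (forall p, D p -> exists t, v t = p), (forall t, D (v t))
    & @quot_rel T (fun p t => p = v t)].
Proof.
pose N (p : baire) (t : {p | D p}) := p = sval t.
have qN : @quot_rel (named N) N by apply: named_quot => t; exists (sval t).
exists (named N), sval; split=> //; last by move=> t; exact: (svalP t).
  apply: qcb0_of_quot qN => -[x Dx] [y Dy] xy; apply: eq_exist; apply: funext => n.
  have oU : open [set t : named N | sval t n = x n].
    rewrite named_openE => p t pt /= tn; exists n.+1 => q s pq qs.
    by rewrite -qs -pq// pt.
  exact/esym/((xy _ oU).1 erefl).
by move=> p Dp; exists (exist _ p Dp).
Qed.

(* A function of two variables out of [Z * X] is called jointly continuous when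
   so are its composites with maps from qcb0-spaces; this is continuity for the
   topology of the product in QCB0, which need not be the Tychonoff topology. *)
Lemma hps_exponential (X Y : topologicalType) : hps X -> hps Y ->
  exists (E : topologicalType) (ev : E -> X -> Y),
  [/\ hps E, (forall e e', (forall x, ev e x = ev e' x) -> e = e'),
      (forall f : X -> Y, continuous f -> exists e, forall x, ev e x = f x),
      (forall (P : topologicalType) (a : P -> E) (b : P -> X), qcb0_space P ->
        continuous a -> continuous b -> continuous (fun w => ev (a w) (b w)))
    & forall (Z : topologicalType) (h : Z -> X -> Y), qcb0_space Z ->
      (forall (P : topologicalType) (a : P -> Z) (b : P -> X), qcb0_space P ->
        continuous a -> continuous b -> continuous (fun w => h (a w) (b w))) ->
      exists2 k : Z -> E, continuous k & forall z x, ev (k z) x = h z x].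
Proof.
move=> [tX [NX hNX]] [tY [NY hNY]].
exists (exp_space NX NY), (fun e => @Continuous.sort X Y e); split.
- split; first exact: (exp_t0 hNX hNY tY).
  by exists (exp_name NX NY); exact: exp_hp_naming.
- by move=> e e' ee'; exact/continuousEP.
- by move=> f cf; exists (mkct cf).
- move=> P a b /quot_of_qcb0[M qM] ca cb.
  have [ga [gaN gac]] := hpn_adm (exp_hp_naming hNX hNY tY)
    (cont_rel_map ca (quot_cont_rel qM)).
  have [gb [gbN gbc]] := hpn_adm hNX (cont_rel_map cb (quot_cont_rel qM)).
  apply: (quot_continuous qM); apply: (cont_rel_lift (unc_exp_cont hNY)).
  exists (fun p => pr2 (ga p) (gb p)); split=> [p x [w Mw <-]|p x j [w Mw _]].
    exists (a w), (b w); rewrite pr2l pr2r.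
    by split=> //; [apply: gaN | apply: gbN]; exists w.
  have [|m Hm] := gac p (a w) j./2; first by exists w.
  have [|n Hn] := gbc p (b w) j./2; first by exists w.
  exists (maxn m n) => q _ [w' Mw' _] pq; rewrite /pr2; case: ifP => _.
    apply: (Hn q (b w')); first by exists w'.
    by apply: agreeW pq; exact: leq_maxr.
  apply: (Hm q (a w')); first by exists w'.
  by apply: agreeW pq; exact: leq_maxl.
move=> Z h qZ hj; have qX : qcb0_space X by apply: hps_qcb0; split; [|exists NX].
have ch z : continuous (h z).
  apply: (hj X (fun=> z) id qX) => x; [exact: cvg_cst | exact: cvg_id].
have [M qM] := quot_of_qcb0 qZ.
have tZ : t0 Z by apply/t0P; case: qZ.
exists (fun z => mkct (ch z)) => //.
apply: (exp_continuous hNY qM).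
(* The test space consists of the pairs of names of [Z] and [X]; joint continuity along it is
   exactly continuity of the uncurried naming. *)
have [T [v [qT vs vD qv]]] := sub_baire_space
  [set u | (exists z, M (prl u) z) /\ exists x, NX (prr u) x].
have /choice[a Ma] : forall t, exists z, M (prl (v t)) z by move=> t; case: (vD t).
have /choice[b Nb] : forall t, exists x, NX (prr (v t)) x by move=> t; case: (vD t).
have ca : continuous a.
  apply: (quot_continuous qv); apply: cont_rel_comp (cts_prl cts_id) _ (quot_cont_rel qM).
  by move=> _ _ [t -> <-]; exact: Ma.
have cb : continuous b.
  apply: (quot_continuous qv); apply: cont_rel_comp (cts_prr cts_id) _ (hpn_cont hNX).
  by move=> _ _ [t -> <-]; exact: Nb.
apply: cont_rel_comp cts_id _ (cont_rel_map (hj T a b qT ca cb) (quot_cont_rel qv)).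
move=> u _ [f [x [[z Mz <-] ux <-]]]; have [|t vt] := vs u.
  by split; [exists z | exists x].
exists t => //=.
have -> : a t = z by apply: (cont_rel_fun tZ (quot_cont_rel qM) (Ma t)); rewrite vt.
by have -> : b t = x by apply: (cont_rel_fun tX (hpn_cont hNX) (Nb t)); rewrite vt.
Qed.

Lemma hps_quotient (K : Type) (c : K -> nat) (Z : K -> topologicalType)
    (Y : topologicalType) (f g : forall k, continuousType (Z k) Y) :
  injective c -> hps Y -> (forall k, hps (Z k)) ->
  exists (Q : topologicalType) (m : continuousType Y Q),
  [/\ hps Q, (forall q, exists y, m y = q),
      (forall k z, m (f k z) = m (g k z))
    & forall (W : topologicalType) (h : continuousType Y W), qcb0_space W ->
      (forall k z, h (f k z) = h (g k z)) ->
      exists u : continuousType Q W, forall y, u (m y) = h y].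
Proof.
move=> ci hY hZ.
have [O [ev [hO ev_inj ev_ex ev_cont _]]] := hps_exponential hY sierp_hps.
have fcomp (X1 X2 X3 : topologicalType) (b : X1 -> X2) (a : X2 -> X3) :
    continuous b -> continuous a -> continuous (a \o b).
  by move=> cb ca x; apply: continuous_comp; [exact: cb | exact: ca].
(* Taking preimages of open sets along [h] is a continuous map of function spaces, so compatibility
   of an open set is an equation between two such maps. *)
have precomp k : exists (Ok : topologicalType) (evk : Ok -> Z k -> sierp),
    [/\ hps Ok, (forall e e', (forall x, evk e x = evk e' x) -> e = e') &
    forall h : continuousType (Z k) Y, exists p : continuousType O Ok,
      forall e z, evk (p e) z = ev e (h z)].
  have [Ok [evk [hOk evk_inj _ _ evkP]]] := hps_exponential (hZ k) sierp_hps.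
  exists Ok, evk; split=> // h.
  have [|p cp pE] := evkP O (fun e z => ev e (h z)) (hps_qcb0 hO).
    move=> P a b qP ca cb; apply: (ev_cont P a (h \o b)) => //.
    exact: fcomp cb (@ct_continuous _ _ h).
  by exists (mkct cp).
have precomp2 k : exists (Ok : topologicalType) (F G : continuousType O Ok),
    hps Ok /\ forall e, F e = G e <-> forall z, ev e (f k z) = ev e (g k z).
  have [Ok [evk [hOk evk_inj evkP]]] := precomp k.
  have [F FE] := evkP (f k); have [G GE] := evkP (g k).
  exists Ok, F, G; split=> // e; split=> [FG z|fg].
    by rewrite -FE FG GE.
  by apply: evk_inj => z; rewrite FE GE fg.
have /choice[R HR] : forall k, exists R : {Ok : topologicalType &
    (continuousType O Ok * continuousType O Ok)%type},
    hps (projT1 R) /\ forall e, (projT2 R).1 e = (projT2 R).2 e <->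
      forall z, ev e (f k z) = ev e (g k z).
  by move=> k; have [Ok [F [G H]]] := precomp2 k; exists (existT _ Ok (F, G)).
have [E [j [hE j_inj jfg jP]]] := @hps_equalizer K c O (fun k => projT1 (R k))
  (fun k => (projT2 (R k)).1) (fun k => (projT2 (R k)).2) ci hO
  (fun k => (HR k).1).
have [B [evB [[tB [NB hNB]] evB_inj _ evB_cont evBP]]] :=
  hps_exponential hE sierp_hps.
have [|eta ceta etaE] := evBP Y (fun y i => ev (j i) y) (hps_qcb0 hY).
  move=> P a b qP ca cb; apply: (ev_cont P (j \o b) a) => //.
  exact: fcomp cb (@ct_continuous _ _ j).
(* Two points are identified exactly when no compatible open set separates them. *)
have eta_eq y y' : eta y = eta y' <-> forall e,
    (forall k z, ev e (f k z) = ev e (g k z)) -> ev e y = ev e y'.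
  split=> [yy' e He|H].
    have [|i <-] := (jfg e).1; first by move=> k; apply/(HR k).2.
    by rewrite -!etaE yy'.
  apply: evB_inj => i; rewrite !etaE; apply: H => k.
  by apply/(HR k).2; apply/(jfg _).2; exists i.
have [tY [N hN]] := hY.
have hA : hp [set p | exists b, NB p b /\ range eta b].
  have := @hp_exb (fun p q => name_graph N NB eta q p)
    (hp2_comp (cts_prr cts_id) (cts_prl cts_id) (name_graph_hp hN hNB tB ceta)).
  apply: hp_ext => p; split=> [[q [y [_ py]]]|[b [pb [y _ yb]]]].
    by exists (eta y); split=> //; exists y.
  by have [q qy] := (hpn_quot hN).1 y; exists q, y; rewrite yb.
pose Q := sub_space NB (range eta).
pose m : Y -> Q := fun y => exist (range eta) (eta y) (imageT eta y).
have cm : continuous m by exact: (sub_continuous hNB (hpn_quot hN)).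
have m_eq y y' : m y = m y' <-> eta y = eta y'.
  by split=> [/(congr1 sval)|yy']; last exact: eq_exist.
exists Q, (mkct cm); split.
- exact: (sub_hps hNB tB hA).
- by move=> [b rb]; have [y _ yb] := rb; exists y; exact: eq_exist.
- by move=> k z; apply/m_eq/eta_eq => e; apply.
move=> W h qW hfg; have tW : t0 W by apply/t0P; case: qW.
(* The preimage of [V] along [h] is a compatible open set, hence a point of [E]. *)
have eV (V : set W) : open V -> exists i, forall y, ev (j i) y = V (h y).
  move=> oV; have oU : open (h @^-1` V).
    by have /continuousP/(_ V oV) := @ct_continuous _ _ h.
  have [e He] := ev_ex _ (sierp_continuous oU).
  have [|i ji] := (jfg e).1; last by exists i => y; rewrite ji He.
  by move=> k; apply/(HR k).2 => z; rewrite !He /preimage/= hfg.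
have mh y y' : m y = m y' -> h y = h y'.
  move=> /m_eq yy'; apply: tW => V oV; have [i Hi] := eV V oV.
  by rewrite -!Hi -!etaE yy'.
have /choice[s sm] : forall q : Q, exists y, m y = q.
  by move=> [b rb]; have [y _ yb] := rb; exists y; exact: eq_exist.
(* The section [s] is arbitrary, yet the preimage of [V] is the set where evaluation at the point
   [i] given by [eV] is true. *)
have cu : continuous (fun q => h (s q)).
  apply/continuousP => V oV; have [i Hi] := eV V oV.
  have ci' : continuous (fun q : Q => evB (sub_in q) i).
    apply: (evB_cont Q _ (fun=> i)) => //.
    - exact: hps_qcb0 (sub_hps hNB tB hA).
    - exact: (@sub_in_continuous _ NB (range eta) hNB).
    - exact: cst_continuous.
  have /continuousP/(_ _ sierp_true_open) := ci'.
  congr open; apply: funext => q; rewrite /preimage /mkset.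
  by rewrite -[in LHS](sm q) etaE Hi.
by exists (mkct cu) => y; apply: mh; exact: sm.
Qed.

(** * Change of index universe and inheritance by full subcategories *)

Section small_index.
Variables (I : Type) (c : I -> nat).
Hypothesis c_inj : injective c.

Definition small : Type := {n : nat | exists i, c i = n}.

Definition small_of (i : I) : small := exist _ (c i) (ex_intro _ i erefl).
Definition of_small (k : small) : I := sval (cid (svalP k)).

Lemma of_smallP k : c (of_small k) = sval k.
Proof. exact: svalP (cid (svalP k)). Qed.

Lemma small_ofK i : of_small (small_of i) = i.
Proof. by apply: c_inj; rewrite of_smallP. Qed.

Lemma of_smallK k : small_of (of_small k) = k.
Proof. by case: k => n kn; apply: eq_exist; rewrite of_smallP. Qed.

Lemma small_inj : injective (sval : small -> nat).
Proof. by move=> [m hm] [n hn] /= mn; exact: eq_exist. Qed.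

Definition of_small_fun (T : I -> Type) (x : forall k, T (of_small k)) i : T i :=
  eq_rect _ T (x (small_of i)) _ (small_ofK i).

Lemma of_small_funE T (x : forall k, T (of_small k)) k :
  of_small_fun x (of_small k) = x k.
Proof.
(* Once the index is generalized and replaced by [k], the transport runs along a proof of a
   reflexive equation. *)
rewrite /of_small_fun; move: (small_ofK _); move: (of_smallK k).
by move: (small_of _) => k' -> e; rewrite (Prop_irrelevance e erefl).
Qed.

Lemma small_ind (Q : I -> Prop) : (forall k, Q (of_small k)) -> forall i, Q i.
Proof. by move=> H i; rewrite -(small_ofK i). Qed.

End small_index.

(* The index type of a limit in [Top] lives in too large a universe for the
   space [forall i, X i] to be formed, hence the detour by a subset of [nat]. *)
Lemma hps_product_large (I : Type) (c : I -> nat) (X : I -> topologicalType) :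
  injective c -> (forall i, hps (X i)) ->
  exists (P : topologicalType) (pr : forall i, continuousType P (X i)),
  [/\ hps P, (forall x y : P, (forall i, pr i x = pr i y) -> x = y)
    & forall (Q : topologicalType) (f : forall i, continuousType Q (X i)),
      qcb0_space Q -> exists u : continuousType Q P,
        forall i t, pr i (u t) = f i t].
Proof.
move=> ci hX; have [P [pr [hP pr_inj prP]]] :=
  hps_product (@small_inj I c) (fun k => hX (of_small k)).
exists P, (of_small_fun ci (T := fun i => continuousType P (X i)) pr); split=> //.
  by move=> x y xy; apply: pr_inj => k; have := xy (of_small k); rewrite of_small_funE.
move=> Q f qQ; have [u uE] := prP Q (fun k => f (of_small k)) qQ.
by exists u; apply: (small_ind ci) => k t; rewrite of_small_funE.
Qed.

Lemma hps_coproduct_large (I : Type) (c : I -> nat) (X : I -> topologicalType) :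
  injective c -> (forall i, hps (X i)) ->
  exists (P : topologicalType) (inj : forall i, continuousType (X i) P),
  [/\ hps P, (forall s, exists i x, s = inj i x)
    & forall (Q : topologicalType) (f : forall i, continuousType (X i) Q),
      exists u : continuousType P Q, forall i x, u (inj i x) = f i x].
Proof.
move=> ci hX; have [P [inj [hP injS injP]]] :=
  hps_coproduct (@small_inj I c) (fun k => hX (of_small k)).
exists P, (of_small_fun ci (T := fun i => continuousType (X i) P) inj); split=> //.
  by move=> s; have [k [x ->]] := injS s; exists (of_small k), x; rewrite of_small_funE.
move=> Q f; have [u uE] := injP Q (fun k => f (of_small k)).
by exists u; apply: (small_ind ci) => k t; rewrite of_small_funE.
Qed.

Lemma hps_iso (X Y : topologicalType) (f : X -> Y) (g : Y -> X) :
  continuous f -> continuous g -> cancel f g -> cancel g f -> hps X -> hps Y.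
Proof.
move=> /continuousP cf cg fK gK [tX [N [[Ns Nq] aN hN]]]; split.
  apply: t0_separated => x y xy; exists X, g; split=> // gxy.
  by apply: xy; rewrite -(gK x) gxy gK.
exists (fun p y => N p (g y)); split.
- split=> [y|U]; first exact: Ns.
  have -> : open U <-> open (f @^-1` U).
    split=> [/cf//|oU]; have /continuousP/(_ _ oU) := cg.
    by congr open; apply/funext => y; rewrite /preimage /mkset gK.
  rewrite Nq; split=> oU p x px Ux.
    have [|n nU] := oU p (g x) px; first by rewrite /preimage /mkset gK.
    by exists n => q y pq qy; have := nU q (g y) pq qy; rewrite /preimage /mkset gK.
  have [|n nU] := oU p (f x) _ Ux; first by rewrite fK.
  by exists n => q y pq qy; apply: (nU q (f y) pq); rewrite fK.
- move=> M /(cont_rel_map cg)/aN[h [hN' hc]]; exists h; split=> [p y My|p y j My].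
    by apply: hN'; exists y.
  have [|m Hm] := hc p (g y) j; first by exists y.
  by exists m => q z Mz; apply: (Hm q (g z)); exists z.
apply: hp_ext hN => u; split=> [[x [ux vx]]|[y [uy vy]]]; last by exists (g y).
by exists (f x); rewrite fK.
Qed.

(** * Uniqueness of universal constructions up to isomorphism *)

Section isomorphisms.
Variable C : category.

Definition iso (x y : C) : Prop := exists (f : hom x y) (g : hom y x),
  g \oc f = idm x /\ f \oc g = idm y.

Lemma product_iso (I : Type) (F : I -> C) p p' (pr : forall i, hom p (F i))
    (pr' : forall i, hom p' (F i)) : is_product pr -> is_product pr' -> iso p p'.
Proof.
move=> H H'; have [f [fE _]] := H' _ pr; have [g [gE _]] := H _ pr'.
exists f, g; split.
  have [w [_ wU]] := H _ pr; rewrite -(wU (g \oc f)) ?(wU (idm _))//.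
    by move=> i; rewrite comp_id_r.
  by move=> i; rewrite comp_assoc gE fE.
have [w [_ wU]] := H' _ pr'; rewrite -(wU (f \oc g)) ?(wU (idm _))//.
  by move=> i; rewrite comp_id_r.
by move=> i; rewrite comp_assoc fE gE.
Qed.

Lemma coproduct_iso (I : Type) (F : I -> C) p p' (inj : forall i, hom (F i) p)
    (inj' : forall i, hom (F i) p') : is_coproduct inj -> is_coproduct inj' -> iso p p'.
Proof.
move=> H H'; have [f [fE _]] := H _ inj'; have [g [gE _]] := H' _ inj.
exists f, g; split.
  have [w [_ wU]] := H _ inj; rewrite -(wU (g \oc f)) ?(wU (idm _))//.
    by move=> i; rewrite comp_id_l.
  by move=> i; rewrite -comp_assoc fE gE.
have [w [_ wU]] := H' _ inj'; rewrite -(wU (f \oc g)) ?(wU (idm _))//.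
  by move=> i; rewrite comp_id_l.
by move=> i; rewrite -comp_assoc gE fE.
Qed.

Lemma equalizer_iso (x y : C) (f g : hom x y) e e' (m : hom e x) (m' : hom e' x) :
  is_equalizer f g m -> is_equalizer f g m' -> iso e e'.
Proof.
move=> [E H] [E' H']; have [u [uE _]] := H' _ _ E; have [v [vE _]] := H _ _ E'.
exists u, v; split.
  have [w [_ wU]] := H _ _ E; rewrite -(wU (v \oc u)) ?(wU (idm _))//.
    by rewrite comp_id_r.
  by rewrite comp_assoc vE uE.
have [w [_ wU]] := H' _ _ E'; rewrite -(wU (u \oc v)) ?(wU (idm _))//.
  by rewrite comp_id_r.
by rewrite comp_assoc uE vE.
Qed.

Lemma coequalizer_iso (x y : C) (f g : hom x y) e e' (m : hom y e) (m' : hom y e') :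
  is_coequalizer f g m -> is_coequalizer f g m' -> iso e e'.
Proof.
move=> [E H] [E' H']; have [u [uE _]] := H _ _ E'; have [v [vE _]] := H' _ _ E.
exists u, v; split.
  have [w [_ wU]] := H _ _ E; rewrite -(wU (v \oc u)) ?(wU (idm _))//.
    by rewrite comp_id_l.
  by rewrite -comp_assoc uE vE.
have [w [_ wU]] := H' _ _ E'; rewrite -(wU (u \oc v)) ?(wU (idm _))//.
  by rewrite comp_id_l.
by rewrite -comp_assoc vE uE.
Qed.

Lemma binary_product_iso (x y p p' : C) (p1 : hom p x) (p2 : hom p y)
    (p1' : hom p' x) (p2' : hom p' y) :
  is_binary_product p1 p2 -> is_binary_product p1' p2' ->
  exists (f : hom p p') (g : hom p' p), [/\ g \oc f = idm p, f \oc g = idm p',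
    p1' \oc f = p1 & p2' \oc f = p2].
Proof.
move=> H H'; have [f [[f1 f2] _]] := H' _ p1 p2; have [g [[g1 g2] _]] := H _ p1' p2'.
exists f, g; split=> //.
  have [w [_ wU]] := H _ p1 p2; rewrite -(wU (g \oc f)) ?(wU (idm _))//.
    by rewrite !comp_id_r.
  by rewrite !comp_assoc g1 g2.
have [w [_ wU]] := H' _ p1' p2'; rewrite -(wU (f \oc g)) ?(wU (idm _))//.
  by rewrite !comp_id_r.
by rewrite !comp_assoc f1 f2.
Qed.

(** The product object is part of the data of an exponential, so it too has to be carried into the
    subcategory. *)
Lemma exponential_iso (x y e p e' p' : C) (p1 : hom p e) (p2 : hom p x) (ev : hom p y)
    (p1' : hom p' e') (p2' : hom p' x) (ev' : hom p' y) :
  is_exponential p1 p2 ev -> is_exponential p1' p2' ev' -> iso e e' /\ iso p p'.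
Proof.
move=> [bp H] [bp' H'].
have [h [[k [k1 k2 kev]] _]] := H' _ _ _ _ bp ev.
have [h' [[k' [k1' k2' kev']] _]] := H _ _ _ _ bp' ev'.
have hh : h' \oc h = idm e.
  have [w [_ wU]] := H _ _ _ _ bp ev; rewrite -(wU (h' \oc h)) ?(wU (idm _))//.
    by exists (idm p); rewrite !comp_id_r comp_id_l.
  exists (k' \oc k); rewrite !comp_assoc k1' -comp_assoc k1 k2' k2 kev' kev.
  by rewrite comp_assoc.
have hh' : h \oc h' = idm e'.
  have [w [_ wU]] := H' _ _ _ _ bp' ev'; rewrite -(wU (h \oc h')) ?(wU (idm _))//.
    by exists (idm p'); rewrite !comp_id_r comp_id_l.
  exists (k \oc k'); rewrite !comp_assoc k1 -comp_assoc k1' k2 k2' kev kev'.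
  by rewrite comp_assoc.
split; first by exists h, h'.
exists k, k'; split.
  have [w [_ wU]] := bp _ p1 p2; rewrite -(wU (k' \oc k)) ?(wU (idm _))//.
    by rewrite !comp_id_r.
  by rewrite !comp_assoc k1' k2' k2 -comp_assoc k1 comp_assoc hh comp_id_l.
have [w [_ wU]] := bp' _ p1' p2'; rewrite -(wU (k \oc k')) ?(wU (idm _))//.
  by rewrite !comp_id_r.
by rewrite !comp_assoc k1 k2 k2' -comp_assoc k1' comp_assoc hh' comp_id_l.
Qed.

End isomorphisms.

Section full_subcategories.
Variables (C : category) (P : C -> Prop).
Let D := full_subcategory P.
Hypothesis P_iso : forall x y, iso x y -> P x -> P y.

(** One instance in [P] suffices: all others are isomorphic to it, and a universal property
    restricts to a full subcategory containing its object. *)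
Lemma full_inherits_products :
  (forall (I : Type) (F : I -> D), countable [set: I] ->
    exists (p : C) (pr : forall i, hom p (sval (F i))), P p /\ is_product pr) ->
  inherits_countable_products P.
Proof.
move=> ex D' I F cI; have [p [pr [Pp H]]] := ex I F cI.
split=> [|p' pr' H']; first by exists p, pr.
exists (P_iso (product_iso H H') Pp) => q f; exact: H' (sval q) f.
Qed.

Lemma full_inherits_coproducts :
  (forall (I : Type) (F : I -> D), countable [set: I] ->
    exists (p : C) (inj : forall i, hom (sval (F i)) p), P p /\ is_coproduct inj) ->
  inherits_countable_coproducts P.
Proof.
move=> ex D' I F cI; have [p [pr [Pp H]]] := ex I F cI.
split=> [|p' pr' H']; first by exists p, pr.
exists (P_iso (coproduct_iso H H') Pp) => q f; exact: H' (sval q) f.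
Qed.

Lemma full_inherits_equalizers :
  (forall (x y : D) (f g : hom (sval x) (sval y)),
    exists (e : C) (m : hom e (sval x)), P e /\ is_equalizer f g m) ->
  inherits_equalizers P.
Proof.
move=> ex D' x y f g; have [e [m [Pe H]]] := ex x y f g.
split=> [|e' m' H']; first by exists e, m.
exists (P_iso (equalizer_iso H H') Pe); split; first exact: H'.1.
move=> q h; exact: H'.2 (sval q) h.
Qed.

Lemma full_inherits_coequalizers :
  (forall (x y : D) (f g : hom (sval x) (sval y)),
    exists (e : C) (m : hom (sval y) e), P e /\ is_coequalizer f g m) ->
  inherits_coequalizers P.
Proof.
move=> ex D' x y f g; have [e [m [Pe H]]] := ex x y f g.
split=> [|e' m' H']; first by exists e, m.
exists (P_iso (coequalizer_iso H H') Pe); split; first exact: H'.1.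
move=> q h; exact: H'.2 (sval q) h.
Qed.

(** The product [r] of [C] lies in [D] and is a product there too; [p] is isomorphic to it over [x]
    and [y]. *)
Lemma full_binary_product (x y p : D) (p1 : hom p x) (p2 : hom p y) :
  (exists (q : C) (q1 : hom q (sval x)) (q2 : hom q (sval y)),
    P q /\ is_binary_product q1 q2) ->
  is_binary_product p1 p2 -> @is_binary_product C (sval x) (sval y) (sval p) p1 p2.
Proof.
move=> [r [r1 [r2 [Pr br]]]] bp.
have brD : @is_binary_product D x y (exist P r Pr) r1 r2.
  by move=> t; exact: br (sval t).
have [a [b [ba ab e1 e2]]] : exists (a : hom (sval p) r) (b : hom r (sval p)),
    [/\ b \oc a = idm (sval p), a \oc b = idm r,
      r1 \oc a = (p1 : hom (sval p) (sval x))
      & r2 \oc a = (p2 : hom (sval p) (sval y))].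
  exact (@binary_product_iso D x y p (exist P r Pr) p1 p2 r1 r2 bp brD).
move=> t t1 t2; have [u [[u1 u2] uU]] := br t t1 t2.
exists (b \oc u); split.
  by rewrite -e1 -e2 -!comp_assoc !(comp_assoc a) ab comp_id_l.
move=> v [v1 v2]; rewrite (uU (a \oc v)).
  by rewrite comp_assoc ba comp_id_l.
by rewrite !comp_assoc e1 e2.
Qed.

(* A product in the subcategory must be one in [C] for the exponential property
   of [C] to apply to it, whence the assumption on binary products. *)
Lemma full_inherits_exponentials :
  (forall x y : D, exists (p : C) (p1 : hom p (sval x)) (p2 : hom p (sval y)),
    P p /\ is_binary_product p1 p2) ->
  (forall x y : D, exists (e p : C) (p1 : hom p e) (p2 : hom p (sval x))
    (ev : hom p (sval y)), [/\ P e, P p & is_exponential p1 p2 ev]) ->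
  inherits_exponentials P.
Proof.
move=> exP ex D' x y; have [e [p [p1 [p2 [ev [Pe Pp H]]]]]] := ex x y.
split=> [|e' p' p1' p2' ev' H']; first by exists e, p, p1, p2, ev.
have [ie ip] := exponential_iso H H'.
exists (P_iso ie Pe), (P_iso ip Pp); split; first by move=> q; exact: H'.1 (sval q).
move=> z q q1 q2 bq g; apply: (H'.2 (sval z) (sval q) q1 q2).
by apply: full_binary_product bq; exact: exP.
Qed.

End full_subcategories.

(** * The category of hyperprojective qcb0-spaces *)

Lemma qcb0_ext (x y : QCB0) (f g : continuousType (sval x) (sval y)) :
  (forall t, f t = g t) -> f = g :> hom x y.
Proof. by move=> fg; exact/continuousEP. Qed.

Lemma qcb0_app (x y : QCB0) (f g : continuousType (sval x) (sval y)) t :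
  f = g :> hom x y -> f t = g t.
Proof. by move=> ->. Qed.

Definition hps_obj (X : topologicalType) (hX : hps X) : QCB0 :=
  exist _ X (hps_qcb0 hX).

Lemma hps_obj_hyperprojective X (hX : hps X) : hyperprojective (hps_obj hX).
Proof. exact/hyperprojectiveP. Qed.

Definition hp_obj (X : topologicalType) (hX : hps X) : QCB0_HP :=
  exist _ (hps_obj hX) (hps_obj_hyperprojective hX).

Lemma hp_obj_hps (x : QCB0_HP) : hps (sval (sval x)).
Proof. exact/hyperprojectiveP/(svalP x). Qed.

Lemma hyperprojective_iso (x y : QCB0) :
  iso x y -> hyperprojective x -> hyperprojective y.
Proof.
move=> [f [g [gf fg]]] /hyperprojectiveP hx; apply/hyperprojectiveP.
apply: (hps_iso (@ct_continuous _ _ f) (@ct_continuous _ _ g)) hx => t.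
  exact: (qcb0_app t gf).
exact: (qcb0_app t fg).
Qed.

Lemma countable_injection (I : Type) : countable [set: I] ->
  exists c : I -> nat, injective c.
Proof.
move=> /pcard_leP/unsquash c; exists c => i j ij.
by apply: (@inj _ _ _ c) => //; rewrite inE.
Qed.

Lemma hyperprojective_product (I : Type) (F : I -> QCB0_HP) (c : I -> nat) :
  injective c -> exists (p : QCB0) (pr : forall i, hom p (sval (F i))),
    hyperprojective p /\ is_product pr.
Proof.
move=> ci; have [P [pr [hP pr_inj prP]]] :=
  hps_product_large ci (fun i => hp_obj_hps (F i)).
exists (hps_obj hP), pr; split; first exact: hps_obj_hyperprojective.
move=> q f; have [u uE] := prP (sval q) f (svalP q).
exists u; split=> [i|v vE]; first by apply: qcb0_ext => t; exact: uE.
apply: qcb0_ext => t; apply: pr_inj => i; rewrite uE.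
exact: esym (qcb0_app t (vE i)).
Qed.

Lemma hyperprojective_coproduct (I : Type) (F : I -> QCB0_HP) (c : I -> nat) :
  injective c -> exists (p : QCB0) (inj : forall i, hom (sval (F i)) p),
    hyperprojective p /\ is_coproduct inj.
Proof.
move=> ci; have [P [inj [hP injS injP]]] :=
  hps_coproduct_large ci (fun i => hp_obj_hps (F i)).
exists (hps_obj hP), inj; split; first exact: hps_obj_hyperprojective.
move=> q f; have [u uE] := injP (sval q) f.
exists u; split=> [i|v vE]; first by apply: qcb0_ext => t; exact: uE.
apply: qcb0_ext => s; have [i [t ->]] := injS s; rewrite uE.
exact: esym (qcb0_app t (vE i)).
Qed.

Lemma unit_inj : injective (fun _ : unit => 0).
Proof. by move=> [] []. Qed.

Lemma hyperprojective_equalizer (x y : QCB0_HP) (f g : hom (sval x) (sval y)) :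
  exists (e : QCB0) (m : hom e (sval x)), hyperprojective e /\ is_equalizer f g m.
Proof.
have [E [m [hE m_inj mfg mP]]] := hps_equalizer (Z := fun _ : unit => sval (sval y))
  (fun=> f) (fun=> g) unit_inj (hp_obj_hps x) (fun=> hp_obj_hps y).
exists (hps_obj hE), m; split; first exact: hps_obj_hyperprojective.
split; first by apply: qcb0_ext => e; apply: (mfg (m e)).2 tt; exists e.
move=> z h fgh; have [_ t|u uE] := mP (sval z) h (svalP z).
  exact: (qcb0_app t fgh).
exists u; split=> [|v vE]; first by apply: qcb0_ext => t; exact: uE.
apply: qcb0_ext => t; apply: m_inj; rewrite uE; exact: esym (qcb0_app t vE).
Qed.

Lemma hyperprojective_coequalizer (x y : QCB0_HP) (f g : hom (sval x) (sval y)) :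
  exists (e : QCB0) (m : hom (sval y) e), hyperprojective e /\ is_coequalizer f g m.
Proof.
have [Q [m [hQ mS mfg mP]]] := hps_quotient (Z := fun _ : unit => sval (sval x))
  (fun=> f) (fun=> g) unit_inj (hp_obj_hps y) (fun=> hp_obj_hps x).
exists (hps_obj hQ), m; split; first exact: hps_obj_hyperprojective.
split; first by apply: qcb0_ext => t; exact: (mfg tt).
move=> z h fgh; have [_ t|u uE] := mP (sval z) h (svalP z).
  exact: (qcb0_app t fgh).
exists u; split=> [|v vE]; first by apply: qcb0_ext => t; exact: uE.
apply: qcb0_ext => s; have [t <-] := mS s; rewrite uE; exact: esym (qcb0_app t vE).
Qed.

Lemma bool_inj : injective nat_of_bool.
Proof. by move=> [] []. Qed.

Lemma hps_binary_product (X Y : topologicalType) : hps X -> hps Y ->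
  exists (P : topologicalType) (p1 : continuousType P X) (p2 : continuousType P Y),
  [/\ hps P, (forall s t, p1 s = p1 t -> p2 s = p2 t -> s = t)
    & forall (Q : topologicalType) (f1 : continuousType Q X)
        (f2 : continuousType Q Y), qcb0_space Q ->
      exists u : continuousType Q P, forall t, p1 (u t) = f1 t /\ p2 (u t) = f2 t].
Proof.
move=> hX hY; pose Z (b : bool) := if b then X else Y.
have hZ b : hps (Z b) by case: b.
have [P [pr [hP pr_inj prP]]] := hps_product_large bool_inj hZ.
exists P, (pr true), (pr false); split=> //.
  by move=> s t e1 e2; apply: pr_inj; case.
move=> Q f1 f2 qQ; pose f b : continuousType Q (Z b) :=
  match b with true => f1 | false => f2 end.
by have [u uE] := prP Q f qQ; exists u => t; split; [exact: (uE true)|exact: (uE false)].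
Qed.

Lemma hyperprojective_binary_product (x y : QCB0_HP) :
  exists (p : QCB0) (p1 : hom p (sval x)) (p2 : hom p (sval y)),
    hyperprojective p /\ is_binary_product p1 p2.
Proof.
have [P [p1 [p2 [hP p_inj pP]]]] := hps_binary_product (hp_obj_hps x) (hp_obj_hps y).
exists (hps_obj hP), p1, p2; split; first exact: hps_obj_hyperprojective.
move=> q q1 q2; have [u uE] := pP (sval q) q1 q2 (svalP q).
exists u; split=> [|v [v1 v2]].
  by split; apply: qcb0_ext => t; have [] := uE t.
apply: qcb0_ext => t; have [u1 u2] := uE t.
apply: p_inj; rewrite ?u1 ?u2; [exact: esym (qcb0_app t v1)|exact: esym (qcb0_app t v2)].
Qed.

(* Global points are read off from constant maps out of the Sierpinski space. *)
Lemma binary_product_points (x y q : QCB0) (q1 : continuousType (sval q) (sval x))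
    (q2 : continuousType (sval q) (sval y)) :
  @is_binary_product QCB0 x y q q1 q2 ->
  (forall a b, exists t, q1 t = a /\ q2 t = b) /\
  (forall s t, q1 s = q1 t -> q2 s = q2 t -> s = t).
Proof.
move=> bq; pose S := hps_obj sierp_hps.
have cst (z : QCB0) (a : sval z) : continuous (fun _ : sierp => a).
  exact: cst_continuous.
split=> [a b|s t e1 e2].
  have [u [[u1 u2] _]] := bq S (mkct (cst x a)) (mkct (cst y b)).
  exists ((u : continuousType sierp (sval q)) True).
  by split; [exact (@qcb0_app S x _ _ True u1) | exact (@qcb0_app S y _ _ True u2)].
have [u [_ uU]] := bq S (mkct (cst x (q1 s))) (mkct (cst y (q2 s))).
have us : u = mkct (cst q s) by apply: uU; split; apply: qcb0_ext.
have ut : u = mkct (cst q t) by apply: uU; split; apply: qcb0_ext => r /=.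
exact (@qcb0_app S q _ _ True (etrans (esym us) ut)).
Qed.

Lemma hyperprojective_exponential (x y : QCB0_HP) :
  exists (e p : QCB0) (p1 : hom p e) (p2 : hom p (sval x)) (ev : hom p (sval y)),
    [/\ hyperprojective e, hyperprojective p & is_exponential p1 p2 ev].
Proof.
have [E [ev [hE ev_inj _ ev_cont evP]]] :=
  hps_exponential (hp_obj_hps x) (hp_obj_hps y).
have [p [p1 [p2 [hp_p bp]]]] := hyperprojective_binary_product (hp_obj hE) x.
have cev : continuous (fun w => ev ((p1 : continuousType (sval p) E) w)
    ((p2 : continuousType (sval p) (sval (sval x))) w)).
  by apply: ev_cont; [exact: (svalP p) | exact: ct_continuous | exact: ct_continuous].
exists (hps_obj hE), p, p1, p2, (mkct cev); split=> //.
  exact: hps_obj_hyperprojective.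
split=> // z q q1 q2 bq g.
have [ptE ptU] := binary_product_points bq.
have /choice[pt Hpt] : forall ab : sval z * sval (sval x), exists t,
    (q1 : continuousType (sval q) (sval z)) t = ab.1 /\
    (q2 : continuousType (sval q) (sval (sval x))) t = ab.2.
  by move=> [a b]; exact: ptE.
pose G : sval q -> sval (sval y) := (g : continuousType (sval q) (sval (sval y))).
have [|h ch hE'] := evP (sval z) (fun a b => G (pt (a, b))) (svalP z).
  (* The maps [a] and [b] induce [k] into [q]; points of [q] are determined by their projections, so
     [pt (a w, b w)] is [k w]. *)
  move=> P a b qP ca cb.
  have [k [[k1 k2] _]] := bq (exist _ P qP) (mkct ca) (mkct cb).
  pose k' : continuousType P (sval q) := k.
  have -> : (fun w => G (pt (a w, b w))) = G \o k'.
    apply: funext => w; congr G; have [e1 e2] := Hpt (a w, b w).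
    apply: ptU; rewrite ?e1 ?e2 /=.
      exact (esym (@qcb0_app (exist _ P qP) z _ _ w k1)).
    exact (esym (@qcb0_app (exist _ P qP) (sval x) _ _ w k2)).
  move=> w; apply: continuous_comp; [exact: (@ct_continuous _ _ k') | exact: ct_continuous].
have ptK t : pt ((q1 : continuousType (sval q) (sval z)) t,
    (q2 : continuousType (sval q) (sval (sval x))) t) = t.
  have [e1 e2] := Hpt ((q1 : continuousType (sval q) (sval z)) t,
    (q2 : continuousType (sval q) (sval (sval x))) t).
  exact: ptU e1 e2.
exists (mkct ch); split.
  have [k [[k1 k2] _]] := bp q (compm (c := QCB0) (mkct ch : hom z (hps_obj hE)) q1) q2.
  exists k; split=> //; apply: qcb0_ext => t.
  have e1 := qcb0_app t k1; have e2 := qcb0_app t k2.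
  exact (etrans (etrans (congr2 ev e1 e2) (hE' _ _)) (congr1 G (ptK t))).
move=> h' [k' [k1 k2 kev]]; apply: qcb0_ext => a; apply: ev_inj => b /=.
rewrite hE'; have [e1 e2] := Hpt (a, b).
have f1 := qcb0_app (pt (a, b)) k1; have f2 := qcb0_app (pt (a, b)) k2.
have f3 := qcb0_app (pt (a, b)) kev.
pose H' : sval z -> E := (h' : continuousType (sval z) E).
exact (etrans (esym f3) (congr2 ev (etrans f1 (congr1 H' e1)) (etrans f2 e2))).
Qed.

(** * Limits and colimits of countable diagrams *)

Section diagrams.
Variables (J : category) (F : functor J QCB0_HP).
Hypothesis cJ : countable_category J.

(** One index type for all arrows, each contributing one pair of maps to equalize or co-equalize. *)
Definition arrow : Type := {ij : J * J & hom ij.1 ij.2}.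

Lemma arrow_code : exists c : arrow -> nat, injective c.
Proof.
have [[c ci] ch] := cJ.
pose d (ij : J * J) := sval (cid (ch ij.1 ij.2)).
have di ij : injective (d ij) := svalP (cid (ch ij.1 ij.2)).
exists (fun a => pickle (c (projT1 a).1, c (projT1 a).2, d _ (projT2 a))).
move=> [[i j] f] [[i' j'] f'] /(pcan_inj pickleK) /= [/ci ii /ci jj]; subst i' j'.
by move=> /di ->.
Qed.

Let X j : topologicalType := sval (sval (F j)).
Let hX j : hps (X j) := hp_obj_hps (F j).
Let Fmap i j (a : hom i j) : continuousType (X i) (X j) := fmap F a.

Lemma hyperprojective_limit :
  exists l (pr : forall j, hom l (F j)), is_limit pr.
Proof.
have [[c ci] _] := cJ; have [d di] := arrow_code.
have [P [pr [hP pr_inj prP]]] := hps_product_large ci hX.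
have [L [m [hL m_inj mE mP]]] := hps_equalizer (Z := fun a : arrow => X (projT1 a).2)
  (fun a => top_comp (Fmap (projT2 a)) (pr (projT1 a).1))
  (fun a => pr (projT1 a).2) di hP (fun a => hX _).
exists (hp_obj hL), (fun j => top_comp (pr j) m); split.
  move=> i j a; apply: (@qcb0_ext (hps_obj hL) (sval (F j))) => t.
  by apply: (mE (m t)).2 (existT _ (i, j) a); exists t.
move=> q f fcone; pose Q : topologicalType := sval (sval q).
have qQ : qcb0_space Q := svalP (sval q).
have [u uE] := prP Q f qQ.
have [[[i j] a] t|v vE] := mP Q u qQ.
  have := @qcb0_app (sval q) (sval (F j)) _ _ t (fcone i j a).
  by rewrite /= !uE.
exists v; split=> [j|w wE].
  apply: (@qcb0_ext (sval q) (sval (F j))) => t.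
  by rewrite /= vE uE.
apply: (@qcb0_ext (sval q) (hps_obj hL)) => t; apply: m_inj; apply: pr_inj => j.
rewrite vE uE; exact (esym (@qcb0_app (sval q) (sval (F j)) _ _ t (wE j))).
Qed.

Lemma hyperprojective_colimit :
  exists l (inj : forall j, hom (F j) l), is_colimit inj.
Proof.
have [[c ci] _] := cJ; have [d di] := arrow_code.
have [P [inj [hP injS injP]]] := hps_coproduct_large ci hX.
have [L [m [hL mS mE mP]]] := hps_quotient (Z := fun a : arrow => X (projT1 a).1)
  (fun a => top_comp (inj (projT1 a).2) (Fmap (projT2 a)))
  (fun a => inj (projT1 a).1) di hP (fun a => hX _).
exists (hp_obj hL), (fun j => top_comp m (inj j)); split.
  move=> i j a; apply: (@qcb0_ext (sval (F i)) (hps_obj hL)) => t.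
  exact: (mE (existT _ (i, j) a) t).
move=> q f fcone; pose Q : topologicalType := sval (sval q).
have qQ : qcb0_space Q := svalP (sval q).
have [u uE] := injP Q f.
have [[[i j] a] t|v vE] := mP Q u qQ.
  have := @qcb0_app (sval (F i)) (sval q) _ _ t (fcone i j a).
  by rewrite /= !uE.
exists v; split=> [j|w wE].
  apply: (@qcb0_ext (sval (F j)) (sval q)) => t.
  by rewrite /= vE uE.
apply: (@qcb0_ext (hps_obj hL) (sval q)) => s.
have [p <-] := mS s; have [j [t ->]] := injS p; rewrite vE uE.
exact (esym (@qcb0_app (sval (F j)) (sval q) _ _ t (wE j))).
Qed.

End diagrams.

Theorem theorem7p1 :
  [/\ cartesian_closed QCB0_HP,
      countably_complete QCB0_HP
    & countably_cocomplete QCB0_HP] /\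
  [/\ inherits_exponentials hyperprojective,
      inherits_countable_products hyperprojective,
      inherits_countable_coproducts hyperprojective,
      inherits_equalizers hyperprojective
    & inherits_coequalizers hyperprojective].
Proof.
have inh_exp : inherits_exponentials hyperprojective.
  apply: full_inherits_exponentials; first exact: hyperprojective_iso.
    exact: hyperprojective_binary_product.
  exact: hyperprojective_exponential.
split; split=> //.
- split=> [|x y|x y].
  + have [|p [pr [hp_p prP]]] := @hyperprojective_product False
      (fun i => match i with end) (fun i => match i with end); first by case.
    exists (exist _ p hp_p) => z.
    have [u [_ uU]] := prP (sval z) (fun i => False_rect _ i).
    by exists u; split=> // v _; apply: uU; case.
  + have [p [p1 [p2 [hp_p bp]]]] := hyperprojective_binary_product x y.
    by exists (exist _ p hp_p), p1, p2 => q; exact: bp (sval q).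
  have [[e [p [p1 [p2 [ev H]]]]] /(_ _ _ _ _ _ H) [he [hp_p H']]] := inh_exp x y.
  by exists (exist _ e he), (exist _ p hp_p), p1, p2, ev.
- by move=> J F cJ; exact: hyperprojective_limit.
- by move=> J F cJ; exact: hyperprojective_colimit.
- apply: full_inherits_products; first exact: hyperprojective_iso.
  by move=> I F /countable_injection[c]; exact: hyperprojective_product.
- apply: full_inherits_coproducts; first exact: hyperprojective_iso.
  by move=> I F /countable_injection[c]; exact: hyperprojective_coproduct.
- apply: full_inherits_equalizers; first exact: hyperprojective_iso.
  exact: hyperprojective_equalizer.
- apply: full_inherits_coequalizers; first exact: hyperprojective_iso.
  exact: hyperprojective_coequalizer.
Qed.
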